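(* Let $M$ be an oriented torsion-free smooth hypersurface embedded in a Weitzenböck $(n+1)$-manifold $\tilde M$. Let $g\colon M\to\mathbb{S}^n$ be the Gauss map. Then, under the identification $\phi\colon TM\to g^*T\mathbb{S}^n$, $$-\phi^{-1}\Delta g=\operatorname{div}(HI+2W^{\mathsf a}),$$ where $H$ is the mean curvature, $I$ is the identity operator, and $W^{\mathsf a}$ is the skew-symmetric part of the Weingarten map. In particular, the Gauss map is harmonic if and only if the smooth $(1,1)$-tensor field $HI+2W^{\mathsf a}$ is divergence-free (that is, $\operatorname{div}(HI+2W^{\mathsf a})=0$).
   Context: A Riemann-Cartan manifold is a Riemannian manifold endowed with a metric-compatible connection $\nabla$, possibly with torsion $T(X,Y)=\nabla_XY-\nabla_YX-[X,Y]$; it is torsion-free if $T=0$ everywhere. A Weitzenböck $(n+1)$-manifold $\tilde M$ is a smooth $(n+1)$-manifold with a fixed global smooth frame $(\tilde E_1,\dots,\tilde E_{n+1})$, equipped with the orientation and the metric making this frame oriented orthonormal, and with the metric-compatible flat connection $\tilde\nabla$ determined by $\tilde\nabla\tilde E_i=0$ for all $i$. An oriented smooth hypersurface $M\subset\tilde M$ carries the restricted metric $\langle\cdot,\cdot\rangle$ and the projected connection $\nabla_XY=(\tilde\nabla_XY)^\top$ (tangential part), so it is a Riemann-Cartan manifold; ''$M$ torsion-free'' refers to the torsion of this $\nabla$. $N$ is the unit normal vector field along $M$ such that a frame $(E_1,\dots,E_n)$ of $M$ is oriented iff $(N,E_1,\dots,E_n)$ is oriented in $\tilde M$. The Weingarten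 map $W$ is the $(1,1)$-tensor field on $M$ with $\langle WX,Y\rangle=\langle N,\tilde\nabla_XY\rangle$ for all tangent fields $X,Y$; $H=\operatorname{tr}W$. For a $(1,1)$-tensor field $A$ with adjoint $A^{\mathsf t}$, $A^{\mathsf a}=\frac12(A-A^{\mathsf t})$ is its skew-symmetric part. ($W$ need not be symmetric.) Gauss map: writing $N=\sum_iN^i\tilde E_i$, $g=(N^1,\dots,N^{n+1})\colon M\to\mathbb{S}^n$. Identification: for $p\in M$ the linear isometry $\phi\colon T_p\tilde M\to\mathbb{R}^{n+1}$ sending a vector to its coefficient vector relative to $(\tilde E_i|_p)$ sends $N|_p$ to $g(p)$ and restricts to an isometry $T_pM\to T_{g(p)}\mathbb{S}^n$; this gives a vector bundle isomorphism $\phi\colon TM\to g^*T\mathbb{S}^n$. For a smooth $(1,1)$-tensor field $A$, $\operatorname{div}A=\sum_i(\nabla_{E_i}A)E_i$ for a local orthonormal frame $(E_i)$ of $M$. The Laplacian (tension field) of $g$ is $\Delta g=\sum_i\big[(g^*\nabla^{\mathbb{S}^n})_{E_i}(\mathrm{d}g(E_i))-\mathrm{d}g(\nabla_{E_i}E_i)\big]\in\Gamma(g^*T\mathbb{S}^n)$, where $\mathbb{S}^n$ has the round metric and its Levi-Civita connection $\nabla^{\mathbb{S}^n}$; $g$ is harmonic iff $\Delta g=0$ everywhere. *)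

(* Defs.v *)
From HB Require Import structures.
From mathcomp Require Import all_boot all_order all_algebra.
From mathcomp Require Import all_classical all_reals all_analysis.
Set Implicit Arguments.
Unset Strict Implicit.
Unset Printing Implicit Defensive.
Import Order.TTheory GRing.Theory Num.Theory.
Import numFieldNormedType.Exports.
Local Open Scope classical_set_scope.
Local Open Scope ring_scope.

Definition dot (R : realType) (k : nat) (u v : 'rV[R]_k) : R :=
  \sum_i u 0 i * v 0 i.

(* [f] is of class C^k at the points of [U]; only used for open sets [U]. *)
Fixpoint Cn_on (R : realType) (m : nat) (V : normedModType R) (k : nat)
    (U : set 'rV[R]_m) (f : 'rV[R]_m -> V) : Prop :=
  match k with
  | 0 => forall x, U x -> {for x, continuous f}
  | k'.+1 => (forall x, U x -> differentiable f x) /\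
             (forall v, Cn_on k' U (fun x => 'd f x v))
  end.

Definition smooth_on (R : realType) (m : nat) (V : normedModType R)
    (U : set 'rV[R]_m) (f : 'rV[R]_m -> V) : Prop :=
  forall k, Cn_on k U f.

(* A chart is stored with its inverse; both maps are total, with irrelevant
   values outside [dom] and [fwd @` dom] respectively. *)
Record chart (R : realType) (T : topologicalType) (m : nat) := Chart {
  dom : set T;
  fwd : T -> 'rV[R]_m;
  bwd : 'rV[R]_m -> T;
  open_dom : open dom;
  open_cod : open (fwd @` dom);
  fwdK : forall p, dom p -> bwd (fwd p) = p;
  fwd_cont : forall p, dom p -> {for p, continuous fwd};
  bwd_cont : forall p, dom p -> {for fwd p, continuous bwd} }.

(* The smooth structure is presented by an atlas indexed by the points, which
   selects a preferred chart around each of them. *)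
Record manifold (R : realType) (m : nat) := Manifold {
  mcarrier :> topologicalType;
  mhausdorff : hausdorff_space mcarrier;
  mcountable : @second_countable mcarrier;
  chart_at : mcarrier -> chart R mcarrier m;
  chart_at_dom : forall p, dom (chart_at p) p;
  chart_compat : forall p q,
    smooth_on (fwd (chart_at p) @` (dom (chart_at p) `&` dom (chart_at q)))
              (fwd (chart_at q) \o bwd (chart_at p)) }.

(* The tangent space of [M] at [p] is ['rV[R]_m], a tangent vector being given
   by its components in the preferred chart at [p]. A field of tangent vectors
   is thus a map [X : M -> 'rV[R]_m], and endomorphisms of the tangent space
   are square matrices acting on row vectors on the right. *)
Section Manifolds.
Context {R : realType} {m : nat} {M : manifold R m}.

Definition mdiff {V : normedModType R} (f : M -> V) (p : M) (v : 'rV[R]_m) : V :=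
  'd (f \o bwd (chart_at p)) (fwd (chart_at p) p) v.

Definition msmooth_on {V : normedModType R} (U : set M) (f : M -> V) : Prop :=
  forall c : M,
    smooth_on (fwd (chart_at c) @` (U `&` dom (chart_at c)))
              (f \o bwd (chart_at c)).

(* Smoothness of the components of [X] in every chart of the atlas. *)
Definition field_on (U : set M) (X : M -> 'rV[R]_m) : Prop :=
  forall c : M,
    msmooth_on (U `&` dom (chart_at c))
               (fun q => mdiff (fwd (chart_at c)) q (X q)).

(* [X, Y]^i = X (Y x^i) - Y (X x^i), with x^i the coordinates of the preferred
   chart at [p]. *)
Definition lie (X Y : M -> 'rV[R]_m) (p : M) : 'rV[R]_m :=
  let x := fwd (chart_at p) in
  mdiff (fun q => mdiff x q (Y q)) p (X p)
  - mdiff (fun q => mdiff x q (X q)) p (Y p).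

(* A sign at each point, that of the coordinate basis of the preferred chart;
   the second clause is continuity: near [p], the coordinate bases of the
   single chart [chart_at p] all have the same orientation. *)
Definition orientation (o : M -> R) : Prop :=
  (forall p, o p = 1 \/ o p = -1) /\
  (forall p, \forall q \near p,
     0 < o p * (o q * \det (lin1_mx (mdiff (fwd (chart_at p)) q)))).

(* The rows of [B] are the vectors of a frame at [p]. *)
Definition oriented_frame (o : M -> R) (p : M) (B : 'M[R]_m) : Prop :=
  0 < o p * \det B.

End Manifolds.

Definition tangent_map (R : realType) (m k : nat) (M : manifold R m)
    (M' : manifold R k) (f : M -> M') (p : M) : 'M[R]_(m, k) :=
  lin1_mx (mdiff (fwd (chart_at (f p)) \o f) p).

Definition smooth_map (R : realType) (m k : nat) (M : manifold R m)
    (M' : manifold R k) (f : M -> M') : Prop :=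
  continuous f /\
  forall c : M', msmooth_on (f @^-1` dom (chart_at c)) (fwd (chart_at c) \o f).

Definition smooth_embedding (R : realType) (m k : nat) (M : manifold R m)
    (M' : manifold R k) (f : M -> M') : Prop :=
  [/\ smooth_map f,
      forall p, row_free (tangent_map f p),
      injective f &
      forall U : set M, open U -> exists2 V : set M', open V & U = f @^-1` V].

Record weitzenbock (R : realType) (k : nat) := Weitzenbock {
  wman :> manifold R k;
  wframe : 'I_k -> wman -> 'rV[R]_k;
  wframe_smooth : forall i, field_on setT (wframe i);
  wframe_basis : forall p, (\matrix_i wframe i p) \in unitmx }.

Section Weitzenbock.
Context {R : realType} {k : nat} {Mt : weitzenbock R k}.

Definition frame_mx (p : Mt) : 'M[R]_k := \matrix_i wframe i p.

(* Coefficients of a tangent vector relative to the parallel frame. *)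
Definition coef (p : Mt) (w : 'rV[R]_k) : 'rV[R]_k := w *m invmx (frame_mx p).

(* The metric for which the frame is orthonormal. *)
Definition wmetric (p : Mt) (u v : 'rV[R]_k) : R := dot (coef p u) (coef p v).

(* The orientation for which the frame is oriented. *)
Definition woriented (p : Mt) (B : 'M[R]_k) : Prop :=
  0 < \det (B *m invmx (frame_mx p)).

(* Covariant derivative of a field [Y] of vectors of [Mt] along [i : M -> Mt]
   for the connection making the frame parallel: by the Leibniz rule, writing
   Y = sum_j Y^j E_j, it is sum_j (d Y^j)(v) E_j. *)
Definition wnabla {m : nat} {M : manifold R m} (i : M -> Mt)
    (Y : M -> 'rV[R]_k) (p : M) (v : 'rV[R]_m) : 'rV[R]_k :=
  mdiff (fun q => coef (i q) (Y q)) p v *m frame_mx (i p).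

End Weitzenbock.

Record hypersurface (R : realType) (n : nat) (Mt : weitzenbock R n.+1) :=
  Hypersurface {
    hman :> manifold R n;
    horn : hman -> R;
    horn_orientation : orientation horn;
    emb : hman -> Mt;
    emb_embedding : smooth_embedding emb }.
Arguments horn {R n Mt} M : rename.
Arguments emb {R n Mt} M : rename.

Section Hypersurface.
Context {R : realType} {n : nat} {Mt : weitzenbock R n.+1}.
Context {M : hypersurface Mt}.

Definition demb (p : M) : 'M[R]_(n, n.+1) := tangent_map (emb M) p.

Definition push (X : M -> 'rV[R]_n) (p : M) : 'rV[R]_n.+1 := X p *m demb p.

Definition gauss (N : M -> 'rV[R]_n.+1) (p : M) : 'rV[R]_n.+1 :=
  coef (emb M p) (N p).

(* Since the frame is smooth, smoothness of [N] along [emb] is that of its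
   coefficients. *)
Definition unit_normal (N : M -> 'rV[R]_n.+1) : Prop :=
  [/\ msmooth_on setT (gauss N),
      forall p, wmetric (emb M p) (N p) (N p) = 1,
      forall p u, wmetric (emb M p) (N p) (u *m demb p) = 0 &
      forall p (B : 'M[R]_n), B \in unitmx ->
        (oriented_frame (horn M) p B <->
         woriented (emb M p) (col_mx (N p) (B *m demb p)))].

(* Sends a tangent vector of [M] to its coefficients in the parallel frame. *)
Definition phi_mx (p : M) : 'M[R]_(n, n.+1) :=
  demb p *m invmx (frame_mx (emb M p)).

(* Inverse of [phi_mx p] on its row space, the tangent space of the sphere at
   the image of [p] by the Gauss map. *)
Definition phi_inv (p : M) (w : 'rV[R]_n.+1) : 'rV[R]_n :=
  w *m pinvmx (phi_mx p).

Definition hmetric (p : M) (u v : 'rV[R]_n) : R :=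
  wmetric (emb M p) (u *m demb p) (v *m demb p).

(* The tangential part w - <w, N> N, as a vector of the tangent space of [M]. *)
Definition tangential (N : M -> 'rV[R]_n.+1) (p : M) (w : 'rV[R]_n.+1) :
    'rV[R]_n :=
  (w - wmetric (emb M p) w (N p) *: N p) *m pinvmx (demb p).

(* [hnabla N Y p v] is the derivative of the field [Y] in the direction [v]. *)
Definition hnabla (N : M -> 'rV[R]_n.+1) (Y : M -> 'rV[R]_n) (p : M)
    (v : 'rV[R]_n) : 'rV[R]_n :=
  tangential N p (wnabla (emb M) (push Y) p v).

Definition torsion_free (N : M -> 'rV[R]_n.+1) : Prop :=
  forall (U : set M) (X Y : M -> 'rV[R]_n),
    open U -> field_on U X -> field_on U Y ->
    forall p, U p -> hnabla N Y p (X p) - hnabla N X p (Y p) - lie X Y p = 0.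

Definition weingarten (N : M -> 'rV[R]_n.+1) (W : M -> 'M[R]_n) : Prop :=
  forall (U : set M) (X Y : M -> 'rV[R]_n),
    open U -> field_on U X -> field_on U Y ->
    forall p, U p ->
      hmetric p (X p *m W p) (Y p)
      = wmetric (emb M p) (N p) (wnabla (emb M) (push Y) p (X p)).

Definition gram (p : M) : 'M[R]_n := phi_mx p *m (phi_mx p)^T.

(* The adjoint for [hmetric], whose matrix is [gram p]: the identity
   u *m adjoint A *m G *m v^T = u *m G *m (v *m A)^T reads A^t G = G A^T. *)
Definition adjoint (p : M) (A : 'M[R]_n) : 'M[R]_n :=
  gram p *m A^T *m invmx (gram p).

Definition skew_part (p : M) (A : 'M[R]_n) : 'M[R]_n :=
  2^-1 *: (A - adjoint p A).

Definition on_frame (U : set M) (E : 'I_n -> M -> 'rV[R]_n) : Prop :=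
  [/\ open U, forall i, field_on U (E i) &
      forall p i j, U p -> hmetric p (E i p) (E j p) = (i == j)%:R].

(* sum_i (nabla_{E_i} A) E_i, where (nabla_X A) Y = nabla_X (A Y) - A nabla_X Y. *)
Definition divergence (N : M -> 'rV[R]_n.+1) (E : 'I_n -> M -> 'rV[R]_n)
    (A : M -> 'M[R]_n) (p : M) : 'rV[R]_n :=
  \sum_i (hnabla N (fun q => E i q *m A q) p (E i p)
          - hnabla N (E i) p (E i p) *m A p).

Definition divergence_free (N : M -> 'rV[R]_n.+1) (A : M -> 'M[R]_n) : Prop :=
  forall (U : set M) (E : 'I_n -> M -> 'rV[R]_n), on_frame U E ->
    forall p, U p -> divergence N E A p = 0.

End Hypersurface.

Definition sphere (R : realType) (k : nat) : set 'rV[R]_k :=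
  [set x | dot x x = 1].

(* Tangent fields of the open subset [O `&` S^(k-1)] of the unit sphere, given
   by a smooth extension to the open subset [O] of the ambient space. *)
Definition sphere_field (R : realType) (k : nat) (O : set 'rV[R]_k)
    (Y : 'rV[R]_k -> 'rV[R]_k) : Prop :=
  [/\ open O, smooth_on O Y &
      forall x, O x -> sphere x -> dot (Y x) x = 0].

(* [D Y q v] is the covariant derivative at [q] of the local field [Y] in the
   direction of the tangent vector [v]. *)
Definition sphere_connection (R : realType) (k : nat)
    (D : ('rV[R]_k -> 'rV[R]_k) -> 'rV[R]_k -> 'rV[R]_k -> 'rV[R]_k) : Prop :=
  forall (O : set 'rV[R]_k) (Y : 'rV[R]_k -> 'rV[R]_k), sphere_field O Y ->
  [/\ forall X, sphere_field O X ->
        exists2 Z, sphere_field O Z &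
          forall x, O x -> sphere x -> Z x = D Y x (X x),
      forall q (a : R) v w, O q -> sphere q -> dot v q = 0 -> dot w q = 0 ->
        D Y q (a *: v + w) = a *: D Y q v + D Y q w,
      forall Y', sphere_field O Y' ->
        (forall x, O x -> sphere x -> Y' x = Y x) ->
        forall q v, O q -> sphere q -> dot v q = 0 -> D Y' q v = D Y q v,
      forall Y', sphere_field O Y' ->
        forall q v, O q -> sphere q -> dot v q = 0 ->
        D (fun x => Y x + Y' x) q v = D Y q v + D Y' q v &
      forall f : 'rV[R]_k -> R^o, smooth_on O f ->
        forall q v, O q -> sphere q -> dot v q = 0 ->
        D (fun x => f x *: Y x) q v = 'd f q v *: Y q + f q *: D Y q v].

(* The Levi-Civita connection of the round metric: metric and torsion-free. The
   bracket of two tangent fields is computed in the ambient space. *)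
Definition sphere_levi_civita (R : realType) (k : nat)
    (D : ('rV[R]_k -> 'rV[R]_k) -> 'rV[R]_k -> 'rV[R]_k -> 'rV[R]_k) : Prop :=
  [/\ sphere_connection D,
      forall O Y Z, sphere_field O Y -> sphere_field O Z ->
        forall q v, O q -> sphere q -> dot v q = 0 ->
        'd (fun x => dot (Y x) (Z x) : R^o) q v
        = dot (D Y q v) (Z q) + dot (Y q) (D Z q v) &
      forall O X Y, sphere_field O X -> sphere_field O Y ->
        forall q, O q -> sphere q ->
        D Y q (X q) - D X q (Y q) - ('d Y q (X q) - 'd X q (Y q)) = 0].

Section TensionField.
Context {R : realType} {n : nat} {Mt : weitzenbock R n.+1}.
Context {M : hypersurface Mt}.

Definition pullback_section (g : M -> 'rV[R]_n.+1) (U : set M)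
    (V : M -> 'rV[R]_n.+1) : Prop :=
  [/\ open U, msmooth_on U V & forall p, U p -> dot (V p) (g p) = 0].

(* [gD] is the connection on the pullback of the tangent bundle of the sphere
   by [g] induced by [D]: the one such that the derivative of [Y \o g] in the
   direction [v] is the derivative of [Y] in the direction [dg v]. *)
Definition pullback_connection (g : M -> 'rV[R]_n.+1)
    (D : ('rV[R]_n.+1 -> 'rV[R]_n.+1) -> 'rV[R]_n.+1 -> 'rV[R]_n.+1 ->
         'rV[R]_n.+1)
    (gD : (M -> 'rV[R]_n.+1) -> M -> 'rV[R]_n -> 'rV[R]_n.+1) : Prop :=
  (forall U V, pullback_section g U V ->
   [/\ forall X, field_on U X ->
         pullback_section g U (fun p => gD V p (X p)),
       forall p (a : R) v w, U p ->
         gD V p (a *: v + w) = a *: gD V p v + gD V p w,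
       forall V', pullback_section g U V' -> (forall p, U p -> V' p = V p) ->
         forall p v, U p -> gD V' p v = gD V p v,
       forall V', pullback_section g U V' -> forall p v, U p ->
         gD (fun q => V q + V' q) p v = gD V p v + gD V' p v &
       forall f : M -> R^o, msmooth_on U f -> forall p v, U p ->
         gD (fun q => f q *: V q) p v = mdiff f p v *: V p + f p *: gD V p v]) /\
  (forall O Y, sphere_field O Y -> forall p v, O (g p) ->
     gD (Y \o g) p v = D Y (g p) (mdiff g p v)).

Definition tension (N : M -> 'rV[R]_n.+1)
    (gD : (M -> 'rV[R]_n.+1) -> M -> 'rV[R]_n -> 'rV[R]_n.+1)
    (g : M -> 'rV[R]_n.+1) (E : 'I_n -> M -> 'rV[R]_n) (p : M) :
    'rV[R]_n.+1 :=
  \sum_i (gD (fun q => mdiff g q (E i q)) p (E i p)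
          - mdiff g p (hnabla N (E i) p (E i p))).

Definition harmonic_map (N : M -> 'rV[R]_n.+1)
    (gD : (M -> 'rV[R]_n.+1) -> M -> 'rV[R]_n -> 'rV[R]_n.+1)
    (g : M -> 'rV[R]_n.+1) : Prop :=
  forall (U : set M) (E : 'I_n -> M -> 'rV[R]_n), on_frame U E ->
    forall p, U p -> tension N gD g E p = 0.

End TensionField.

(* Main.v *)
Require Import Defs.
From HB Require Import structures.
From mathcomp Require Import all_boot all_order all_algebra perm.
From mathcomp Require Import all_classical all_reals all_analysis.
From mathcomp Require Import ring lra.
Import Order.TTheory GRing.Theory Num.Theory.
Import numFieldNormedType.Exports.
Local Open Scope classical_set_scope.
Local Open Scope ring_scope.
Set Implicit Arguments.
Unset Strict Implicit.
Unset Printing Implicit Defensive.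

(** Written in the parallel frame, a tangent field [Y] of [M] becomes the map
[coef_field Y] from [M] to R^(n+1), and the projected connection becomes the
derivative of that map followed by the orthogonal projection [orthproj] onto
the complement of the Gauss map g ([hnabla_coef]). The connection induced on
the pullback by g of the tangent bundle of the sphere is the same projected
derivative: the axioms of the Levi-Civita connection determine it on the fields
[fun x => orthproj x w] ([levi_civita_orthproj]), and every section of the
pullback is a combination of such fields ([pullback_connectionE]). So the
covariant derivative of a tangent field and that of its image under phi
correspond to each other. Differentiating the relation <g, phi Y> = 0 gives
dg = - phi W, hence the tension field of g is - phi (div W).

It remains to show that div W = div (H I + W - W^t), that is,
div W^t = div (H I), where the right-hand side is the gradient of H. This is
the trace of the Codazzi equation (nabla_X W) Y = (nabla_Y W) X
([codazzi_trace]). The Codazzi equation itself says that the second derivatives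
of g commute: X (dg Y) - Y (dg X) = dg [X, Y] ([mdiff_lie], which rests on the
symmetry [diff_diff_sym] of second derivatives), where
[X, Y] = nabla_X Y - nabla_Y X because the torsion vanishes.

All this is computed in components with respect to an orthonormal frame. The
components of W are scalar products of derivatives of g with maps [coef_field],
so that differentiability of the latter ([coef_field_is_mdiff]) suffices. *)

(** * Rules for differentials *)

Lemma is_diffE (R : numFieldType) (V W : normedModType R) (f df : V -> W) x :
  is_diff x f df -> forall v, 'd f x v = df v.
Proof. by case=> _ ->. Qed.

Lemma is_diff_differentiable (R : numFieldType) (V W : normedModType R)
    (f df : V -> W) x :
  is_diff x f df -> differentiable f x.
Proof. by case. Qed.

(** Charts vary with the point on a manifold, so most identities between maps
only hold near a point; this is what lets them be differentiated. *)
Lemma is_diff_near (R : numFieldType) (V W : normedModType R)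
    (f g df : V -> W) x :
  (\near x, f x = g x) -> is_diff x f df -> is_diff x g df.
Proof.
move=> fg [fx <-].
have fgx := nbhs_singleton fg.
have [dc dE] := (diff_locallyP _ _).1 fx.
have gE : g \o shift x = cst (g x) + 'd f x +o_ (0 : V) id.
  apply/eqaddoP => e e0; rewrite -fgx.
  have /eqaddoP/(_ _ e0) := dE; apply: filter_app.
  have H : \forall h \near (0 : V), f (h + x) = g (h + x).
    have := fg; rewrite (near_shift 0 x); apply: filterS => h /=.
    by rewrite subr0.
  apply: filterS H => h H.
  by rewrite /= !fctE /= H.
have dgE := diff_unique dc gE.
apply: DiffDef; last by rewrite dgE.
by apply/diff_locallyP; rewrite dgE.
Qed.

Lemma is_diff_bilinear (R : numFieldType) (U V1 V2 W : normedModType R)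
    (b : {bilinear V1 -> V2 -> W}) (f df : U -> V1) (g dg : U -> V2) x :
  continuous (fun p => b p.1 p.2) -> is_diff x f df -> is_diff x g dg ->
  is_diff x (fun y => b (f y) (g y)) (fun v => b (f x) (dg v) + b (df v) (g x)).
Proof.
move=> bc fx gx.
have h : is_diff (f x, g x) (fun q => b q.1 q.2)
   (fun q => b (f x) q.2 + b q.1 (g x)).
  by apply: DiffDef; [apply: differentiable_bilin|rewrite diff_bilin].
exact: (is_diff_comp (is_diff_pair fx gx) h).
Qed.

Section Scale.
Variables (R : numFieldType) (W : normedModType R).

(** Scalar multiplication under a name of its own, on which a bilinear
structure can be declared. *)
Definition scale_map (a : R^o) (w : W) : W := a *: w.

Lemma scale_is_bilinear :
  bilinear_for
    (GRing.Scale.Law.clone _ _ *:%R _) (GRing.Scale.Law.clone _ _ *:%R _)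
    scale_map.
Proof.
rewrite /scale_map; split=> [u'|u] a x y /=; first by rewrite scalerDl scalerA.
by rewrite scalerDr !scalerA mulrC.
Qed.

HB.instance Definition _ := bilinear_isBilinear.Build R R^o W W _ _
  scale_map scale_is_bilinear.

Lemma is_diff_scale (U : normedModType R) (f df : U -> R^o) (g dg : U -> W) x :
  is_diff x f df -> is_diff x g dg ->
  is_diff x (fun y => f y *: g y) (fun v => f x *: dg v + df v *: g x).
Proof.
apply: (is_diff_bilinear (b := scale_map)).
move=> p; exact: scale_continuous.
Qed.

End Scale.

Lemma is_diff_sum (R : numFieldType) (V W : normedModType R) (I : Type)
    (r : seq I) (P : pred I) (f df : I -> V -> W) x :
  (forall i, P i -> is_diff x (f i) (df i)) ->
  is_diff x (fun y => \sum_(i <- r | P i) f i y)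
    (fun v => \sum_(i <- r | P i) df i v).
Proof.
move=> fi; elim: r => [|i r ih].
  have -> : (fun y => \sum_(i <- [::] | P i) f i y) = cst 0.
    by apply/funext => y; rewrite big_nil.
  have -> : (fun y => \sum_(i <- [::] | P i) df i y) = 0.
    by apply/funext => y; rewrite big_nil.
  exact: is_diff_cst.
have -> : (fun y => \sum_(i <- i :: r | P i) f i y) =
   if P i then f i \+ (fun y => \sum_(i <- r | P i) f i y)
   else (fun y => \sum_(i <- r | P i) f i y).
  by apply/funext => y; rewrite big_cons; case: ifP.
have -> : (fun y => \sum_(i <- i :: r | P i) df i y) =
   if P i then df i \+ (fun y => \sum_(i <- r | P i) df i y)
   else (fun y => \sum_(i <- r | P i) df i y).
  by apply/funext => y; rewrite big_cons; case: ifP.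
by case: ifP => // Pi; apply: is_diffD; apply: fi.
Qed.

Section Entries.
Variables (R : numFieldType) (V : normedModType R) (m n : nat).

Lemma is_diff_entry (f df : V -> 'M[R]_(m, n)) i j x :
  is_diff x f df -> is_diff x (fun y => f y i j : R^o) (fun v => df v i j).
Proof.
move=> fx.
have lin : linear (fun A : 'M[R]_(m, n) => A i j : R^o).
  by move=> a A B; rewrite !mxE.
pose L : {linear 'M[R]_(m, n) -> R^o} :=
  HB.pack (fun A : 'M[R]_(m, n) => A i j : R^o)
    (GRing.isLinear.Build _ _ _ _ _ lin).
have cL : continuous L by exact: coord_continuous.
have h : is_diff (f x) L L.
  by apply: DiffDef; [exact: linear_differentiable|exact: diff_lin].
exact: (is_diff_comp fx h).
Qed.

Lemma is_diff_mx (f df : V -> 'M[R]_(m, n)) x :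
  (forall i j, is_diff x (fun y => f y i j : R^o) (fun v => df v i j)) ->
  is_diff x f df.
Proof.
move=> fx.
have E (h : V -> 'M[R]_(m, n)) :
    h = (fun y => \sum_i \sum_j h y i j *: delta_mx i j).
  by apply/funext => y; exact: matrix_sum_delta.
rewrite (E f) (E df); apply: is_diff_sum => i _; apply: is_diff_sum => j _.
have h := is_diff_scale (fx i j) (is_diff_cst (delta_mx i j : 'M[R]_(m, n)) x).
apply: is_diff_eq h _.
by apply/funext => v /=; rewrite scaler0 add0r.
Qed.

End Entries.

Lemma is_diff_mulmx (R : numFieldType) (V : normedModType R) (m n p : nat)
    (f df : V -> 'M[R]_(m, n)) (g dg : V -> 'M[R]_(n, p)) x :
  is_diff x f df -> is_diff x g dg ->
  is_diff x (fun y => f y *m g y) (fun v => f x *m dg v + df v *m g x).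
Proof.
move=> fx gx; apply: is_diff_mx => i k.
have h j := is_diff_scale (is_diff_entry i j fx) (is_diff_entry j k gx).
have /= hs := @is_diff_sum _ _ _ _ (index_enum 'I_n) xpredT _ _ x
  (fun j _ => h j).
have -> : (fun y => (f y *m g y) i k : R^o) =
  (fun y => \sum_j f y i j *: (g y j k : R^o)).
  by apply/funext => y; rewrite mxE.
apply: is_diff_eq hs _.
by apply/funext => v; rewrite !mxE big_split.
Qed.

Lemma is_diff_trmx (R : numFieldType) (V : normedModType R) (m n : nat)
    (f df : V -> 'M[R]_(m, n)) x :
  is_diff x f df -> is_diff x (fun y => (f y)^T) (fun v => (df v)^T).
Proof.
move=> fx; apply: is_diff_mx => i j.
have -> : (fun y => (f y)^T i j : R^o) = (fun y => f y j i).
  by apply/funext => y; rewrite mxE.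
apply: is_diff_eq (is_diff_entry j i fx) _.
by apply/funext => y; rewrite mxE.
Qed.

Lemma dot_mulmx (R : realType) k (u v : 'rV[R]_k) : dot u v = (u *m v^T) 0 0.
Proof. by rewrite mxE; apply: eq_bigr => i _; rewrite mxE. Qed.

Lemma is_diff_dot (R : realType) (V : normedModType R) (k : nat)
    (f df g dg : V -> 'rV[R]_k) x :
  is_diff x f df -> is_diff x g dg ->
  is_diff x (fun y => dot (f y) (g y) : R^o)
    (fun v => dot (f x) (dg v) + dot (df v) (g x)).
Proof.
move=> fx gx.
have h := is_diff_entry 0 0 (is_diff_mulmx fx (is_diff_trmx gx)).
have -> : (fun y => dot (f y) (g y) : R^o) = (fun y => (f y *m (g y)^T) 0 0).
  by apply/funext => y; rewrite dot_mulmx.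
by apply: is_diff_eq h _; apply/funext => v; rewrite !dot_mulmx mxE.
Qed.

Lemma differentiable_det (R : numFieldType) (V : normedModType R) (n : nat)
    (f : V -> 'M[R]_n) x :
  differentiable f x -> differentiable (fun y => \det (f y) : R^o) x.
Proof.
move=> fx; rewrite /determinant.
have h (s : 'S_n) (r : seq 'I_n) :
    differentiable (fun y => \prod_(i <- r) f y i (s i) : R^o) x.
  elim: r => [|i r ih].
    have -> : (fun y => \prod_(i <- [::]) f y i (s i) : R^o) = cst 1.
      by apply/funext => y; rewrite big_nil.
    exact: differentiable_cst.
  have -> : (fun y => \prod_(i <- i :: r) f y i (s i) : R^o) =
    (fun y => f y i (s i) *: (\prod_(i <- r) f y i (s i) : R^o)).
    by apply/funext => y; rewrite big_cons.
  have [//] := is_diff_scale (is_diff_entry i (s i) (differentiableP fx))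
    (differentiableP ih).
have [//] := @is_diff_sum _ _ _ _ (index_enum 'S_n) xpredT
  (fun (s : 'S_n) y => (-1) ^+ s *: (\prod_(i < n) f y i (s i) : R^o)) _ x
  (fun s _ => is_diffZ ((-1) ^+ s) (differentiableP (h s _))).
Qed.

Lemma differentiable_mx (R : numFieldType) (V : normedModType R) (m n : nat)
    (f : V -> 'M[R]_(m, n)) x :
  (forall i j, differentiable (fun y => f y i j : R^o) x) -> differentiable f x.
Proof.
move=> fx.
suff [] : is_diff x f (fun v => \matrix_(i, j) 'd (fun y => f y i j : R^o) x v).
  by [].
apply: is_diff_mx => i j; apply: is_diff_eq (differentiableP (fx i j)) _.
by apply/funext => v; rewrite mxE.
Qed.

(** Near an invertible matrix, Cramer's formula expresses the inverse as a
rational function of the entries. *)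
Lemma differentiable_invmx (R : numFieldType) (V : normedModType R) (n : nat)
    (f : V -> 'M[R]_n) x :
  differentiable f x -> f x \in unitmx ->
  differentiable (fun y => invmx (f y)) x.
Proof.
move=> fx ux.
have dx := differentiable_det fx.
have d0 : \det (f x) != 0 by rewrite -unitfE -unitmxE.
have near_unit : \forall y \near x, \det (f y) != 0.
  have /cvgr_neq0 := differentiable_continuous dx.
  by apply.
suff h : differentiable (fun y => ((\det (f y))^-1 : R^o) *: \adj (f y)) x.
  have [] // := is_diff_near (g := fun y => invmx (f y)) _ (differentiableP h).
  apply: filterS near_unit => y dy.
  by rewrite /invmx unitmxE unitfE dy.
have ax : differentiable (fun y => \adj (f y)) x.
  apply: differentiable_mx => i j.
  have -> : (fun y => (\adj (f y)) i j : R^o) =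
    (fun y => (-1) ^+ (j + i) *: (\det (row' j (col' i (f y))) : R^o)).
    by apply/funext => y; rewrite mxE /cofactor.
  have h : differentiable (fun y => row' j (col' i (f y))) x.
    apply: differentiable_mx => a b.
    have -> : (fun y => (row' j (col' i (f y))) a b : R^o) =
      (fun y => f y (lift j a) (lift i b)) by apply/funext => y; rewrite !mxE.
    by have [] := is_diff_entry (lift j a) (lift i b) (differentiableP fx).
  exact: differentiableZ (differentiable_det h).
by have [] := is_diff_scale (differentiableP (differentiableV dx d0))
  (differentiableP ax).
Qed.

(** * Smooth maps between normed spaces *)

Lemma near_open (T : topologicalType) (A : set T) x :
  open A -> A x -> \forall y \near x, A y.
Proof. by move=> oA Ax; apply: open_nbhs_nbhs. Qed.

Section SmoothMaps.
Variables (R : realType) (m : nat) (U : set 'rV[R]_m).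
Hypothesis oU : open U.

Lemma Cn_on_eq (V : normedModType R) k (f g : 'rV[R]_m -> V) :
  (forall x, U x -> f x = g x) -> Cn_on k U f -> Cn_on k U g.
Proof.
elim: k f g => [|k ih] f g fg /=.
  move=> fc x Ux; have := fc x Ux.
  rewrite /prop_for /continuous_at /= (fg x Ux).
  have fgx : \forall y \near x, f y = g y.
    by apply: filterS (near_open oU Ux) => y /fg.
  exact: cvg_trans (near_eq_cvg fgx).
have nfg x : U x -> \forall y \near x, f y = g y.
  by move=> Ux; apply: filterS (near_open oU Ux) => y /fg.
move=> [fd fC]; split=> [x Ux|v].
  by have [] := is_diff_near (nfg x Ux) (differentiableP (fd x Ux)).
apply: ih (fC v) => x Ux.
exact: esym (is_diffE (is_diff_near (nfg x Ux) (differentiableP (fd x Ux))) v).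
Qed.

Lemma Cn_onW (V : normedModType R) k (f : 'rV[R]_m -> V) :
  Cn_on k.+1 U f -> Cn_on k U f.
Proof.
elim: k f => [|k ih] f [fd fC].
  by move=> x Ux; exact: differentiable_continuous (fd x Ux).
by split=> // v; apply: ih; exact: fC.
Qed.

Lemma Cn_on_cst (V : normedModType R) k (a : V) : Cn_on k U (cst a).
Proof.
elim: k a => [|k ih] a /=; first by move=> x _; exact: cst_continuous.
split=> [x _|v]; first exact: differentiable_cst.
have -> : (fun x => 'd (cst a) x v) = cst 0 :> ('rV[R]_m -> V).
  by apply/funext => x; rewrite diff_val.
exact: ih.
Qed.

Lemma Cn_onD (V : normedModType R) k (f g : 'rV[R]_m -> V) :
  Cn_on k U f -> Cn_on k U g -> Cn_on k U (fun x => f x + g x).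
Proof.
elim: k f g => [|k ih] f g.
  by move=> fc gc x Ux; apply: continuousD; [exact: fc|exact: gc].
move=> [fd fC] [gd gC]; split=> [x Ux|v].
  by apply: differentiableD; [exact: fd|exact: gd].
apply: Cn_on_eq (ih _ _ (fC v) (gC v)) => x Ux.
exact: esym (congr1 (@^~ v) (diffD (fd x Ux) (gd x Ux))).
Qed.

Lemma Cn_on_scale (V : normedModType R) k (f : 'rV[R]_m -> R^o)
    (g : 'rV[R]_m -> V) :
  Cn_on k U f -> Cn_on k U g -> Cn_on k U (fun x => f x *: g x).
Proof.
elim: k f g => [|k ih] f g.
  by move=> fc gc x Ux; apply: continuousZ; [exact: fc|exact: gc].
move=> fk gk; have [fd fC] := fk; have [gd gC] := gk.
have h x Ux := is_diff_scale (differentiableP (fd x Ux))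
  (differentiableP (gd x Ux)).
split=> [x Ux|v]; first by have [] := h x Ux.
have := Cn_onD (ih _ _ (Cn_onW fk) (gC v)) (ih _ _ (fC v) (Cn_onW gk)).
apply: Cn_on_eq => x Ux.
exact: esym (is_diffE (h x Ux) v).
Qed.

Lemma Cn_on_entry (p q : nat) k (f : 'rV[R]_m -> 'M[R]_(p, q)) i j :
  Cn_on k U f -> Cn_on k U (fun x => f x i j : R^o).
Proof.
elim: k f => [|k ih] f.
  move=> fc x Ux; have := @coord_continuous R p q i j (f x).
  exact: (continuous_comp (fc x Ux)).
move=> [fd fC].
have h x Ux := is_diff_entry i j (differentiableP (fd x Ux)).
split=> [x Ux|v]; first by have [] := h x Ux.
apply: Cn_on_eq (ih _ (fC v)) => x Ux.
exact: esym (is_diffE (h x Ux) v).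
Qed.

Lemma Cn_on_id k : Cn_on k U id.
Proof.
case: k => [|k]; first by move=> x _; exact: cvg_id.
split=> [x _|v]; first by have [] := is_diff_id x.
have -> : (fun x => 'd id x v) = cst v :> ('rV[R]_m -> 'rV[R]_m).
  by apply/funext => x; rewrite diff_val.
exact: Cn_on_cst.
Qed.

Lemma smooth_on_eq (V : normedModType R) (f g : 'rV[R]_m -> V) :
  (forall x, U x -> f x = g x) -> smooth_on U f -> smooth_on U g.
Proof. by move=> fg fs k; exact: Cn_on_eq fg (fs k). Qed.

Lemma smooth_on_cst (V : normedModType R) (a : V) : smooth_on U (cst a).
Proof. by move=> k; exact: Cn_on_cst. Qed.

Lemma smooth_on_id : smooth_on U id.
Proof. by move=> k; exact: Cn_on_id. Qed.

Lemma smooth_onD (V : normedModType R) (f g : 'rV[R]_m -> V) :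
  smooth_on U f -> smooth_on U g -> smooth_on U (fun x => f x + g x).
Proof. by move=> fs gs k; exact: Cn_onD (fs k) (gs k). Qed.

Lemma smooth_on_scale (V : normedModType R) (f : 'rV[R]_m -> R^o)
    (g : 'rV[R]_m -> V) :
  smooth_on U f -> smooth_on U g -> smooth_on U (fun x => f x *: g x).
Proof. by move=> fs gs k; exact: Cn_on_scale (fs k) (gs k). Qed.

Lemma smooth_on_entry (p q : nat) (f : 'rV[R]_m -> 'M[R]_(p, q)) i j :
  smooth_on U f -> smooth_on U (fun x => f x i j : R^o).
Proof. by move=> fs k; exact: Cn_on_entry (fs k). Qed.

Lemma smooth_on_diff (V : normedModType R) (f : 'rV[R]_m -> V) v :
  smooth_on U f -> smooth_on U (fun x => 'd f x v).
Proof. by move=> fs k; have [_] := fs k.+1; apply. Qed.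

Lemma smooth_on_differentiable (V : normedModType R) (f : 'rV[R]_m -> V) x :
  smooth_on U f -> U x -> differentiable f x.
Proof. by move=> fs; have [+ _] := fs 1; apply. Qed.

Lemma smooth_on_sum (V : normedModType R) (I : Type) (r : seq I)
    (f : I -> 'rV[R]_m -> V) :
  (forall i, smooth_on U (f i)) -> smooth_on U (fun x => \sum_(i <- r) f i x).
Proof.
move=> fs; elim: r => [|i r ih].
  by apply: smooth_on_eq (smooth_on_cst 0) => x _; rewrite big_nil.
by apply: smooth_on_eq (smooth_onD (fs i) ih) => x _; rewrite big_cons.
Qed.

Lemma smooth_on_dot (p : nat) (f g : 'rV[R]_m -> 'rV[R]_p) :
  smooth_on U f -> smooth_on U g ->
  smooth_on U (fun x => dot (f x) (g x) : R^o).
Proof.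
move=> fs gs; apply: smooth_on_sum => i.
exact: smooth_on_scale (smooth_on_entry _ _ fs) (smooth_on_entry _ _ gs).
Qed.

(** The differential is expanded along the standard basis, so that only
directional derivatives in fixed directions have to be differentiated. *)
Lemma diff_row_sum (V : normedModType R) (f : 'rV[R]_m -> V) x v :
  'd f x v = \sum_j v 0 j *: 'd f x (delta_mx 0 j).
Proof.
rewrite [in LHS](row_sum_delta v) raddf_sum; apply: eq_bigr => j _.
exact: linearZZ.
Qed.

Lemma smooth_on_diff_field (V : normedModType R) (f : 'rV[R]_m -> V)
    (Z : 'rV[R]_m -> 'rV[R]_m) :
  smooth_on U f -> smooth_on U Z -> smooth_on U (fun x => 'd f x (Z x)).
Proof.
move=> fs Zs.
apply: (@smooth_on_eq _ (fun x => \sum_j Z x 0 j *: 'd f x (delta_mx 0 j))).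
  by move=> x _; rewrite [RHS]diff_row_sum.
apply: smooth_on_sum => j.
exact: smooth_on_scale (smooth_on_entry _ _ Zs) (smooth_on_diff _ fs).
Qed.

End SmoothMaps.

(** * Symmetry of second derivatives *)

Lemma is_derive_line (R : realType) (V : normedModType R) (F : V -> R^o)
    (x u : V) (s : R) :
  differentiable F (x + s *: u) ->
  is_derive s 1 (fun t => F (x + t *: u) : R) ('d F (x + s *: u) u).
Proof.
move=> dF.
have h1 : is_diff s (fun t : R => x + t *: u) ( *:%R ^~ u).
  have := is_diffD (is_diff_cst x s) (is_diff_scalel s u).
  by move=> h; apply: is_diff_eq h _; apply/funext => t /=; rewrite add0r.
have h2 : is_diff (x + s *: u) F ('d F (x + s *: u)) by exact: differentiableP.
have h3 := is_diff_comp h1 h2.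
apply: DeriveDef; first exact: diff_derivable (is_diff_differentiable h3).
by rewrite (deriveE _ (is_diff_differentiable h3)) (is_diffE h3) /= scale1r.
Qed.

Section Young.
Variables (R : realType) (m : nat) (U : set 'rV[R]_m).
Hypothesis oU : open U.

(** Two successive applications of the mean value theorem to the alternating
sum of the values of [f] at the corners of a parallelogram. *)
Lemma second_difference (f : 'rV[R]_m -> R^o) x u v (h : R) : 0 < h ->
  (forall y, U y -> differentiable f y) ->
  (forall y, U y -> differentiable (fun z => 'd f z u : R^o) y) ->
  (forall a b, 0 <= a <= h -> 0 <= b <= h -> U (x + a *: u + b *: v)) ->
  exists a b, [/\ 0 <= a <= h, 0 <= b <= h &
    f (x + h *: u + h *: v) - f (x + h *: u) - f (x + h *: v) + f x =
    'd (fun z => 'd f z u : R^o) (x + a *: u + b *: v) v * h * h].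
Proof.
move=> h0 df ddf inU.
have hh : 0 <= h <= h by rewrite ltW ?lexx.
have zh : 0 <= (0 : R) <= h by rewrite lexx ltW.
have inU0 a : 0 <= a <= h -> U (x + a *: u).
  by move=> ah; have := inU a 0 ah zh; rewrite scale0r addr0.
pose phi := fun s : R => (f (x + h *: v + s *: u) - f (x + s *: u) : R).
have dphi s : 0 <= s <= h -> is_derive s 1 phi
    ('d f (x + h *: v + s *: u) u - 'd f (x + s *: u) u).
  move=> sh; apply: is_deriveB; apply: is_derive_line; apply: df.
    by rewrite addrAC; exact: inU.
  exact: inU0.
have cphi : {within `[0, h], continuous phi}.
  apply: derivable_within_continuous => s; rewrite in_itv /= => sh.
  by have [] := dphi s sh.
have [a ah Ea] := MVT h0 (fun s sh => dphi s (subset_itv_oo_cc sh)) cphi.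
have {}ah : 0 <= a <= h by have := subset_itv_oo_cc ah; rewrite in_itv.
pose psi := fun t : R => ('d f (x + a *: u + t *: v) u : R).
have dpsi t : 0 <= t <= h -> is_derive t 1 psi
    ('d (fun z => 'd f z u : R^o) (x + a *: u + t *: v) v).
  move=> th; have := @is_derive_line R _ (fun z => 'd f z u) (x + a *: u) v t.
  by apply; apply: ddf; exact: inU.
have cpsi : {within `[0, h], continuous psi}.
  apply: derivable_within_continuous => s; rewrite in_itv /= => sh.
  by have [] := dpsi s sh.
have [b bh Eb] := MVT h0 (fun s sh => dpsi s (subset_itv_oo_cc sh)) cpsi.
have {}bh : 0 <= b <= h by have := subset_itv_oo_cc bh; rewrite in_itv.
exists a, b; split=> //.
move: Ea Eb; rewrite /phi /psi subr0 !scale0r !addr0 => Ea Eb.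
rewrite -Eb [x + h *: u + _]addrAC [x + a *: u + _]addrAC -Ea.
by rewrite opprB addrA addrAC [in RHS]addrAC.
Qed.

(** Both mixed second derivatives at [x] are close to the same second
difference divided by the square of the side, since each equals it at some
point of a small parallelogram and both are continuous. *)
Lemma diff_diff_sym_scalar (f : 'rV[R]_m -> R^o) x u v :
  Cn_on 2 U f -> U x ->
  'd (fun y => 'd f y u : R^o) x v = 'd (fun y => 'd f y v : R^o) x u.
Proof.
move=> [df ddf] Ux.
pose G := fun y => 'd (fun z => 'd f z u : R^o) y v : R^o.
pose H := fun y => 'd (fun z => 'd f z v : R^o) y u : R^o.
have Gc : {for x, continuous G} by have [_ /(_ v)] := ddf u; apply.
have Hc : {for x, continuous H} by have [_ /(_ u)] := ddf v; apply.
apply/eqP/negPn/negP => GH.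
(* Within [e] of their values at [x], [G] and [H] cannot coincide. *)
pose e := `|G x - H x| / 2.
have e0 : 0 < e by rewrite divr_gt0 // normr_gt0 subr_eq0.
have [d /= d0 dball] : exists2 d : R, 0 < d & forall y, `|x - y| < d ->
    [/\ U y, `|G x - G y| < e & `|H x - H y| < e].
  have : \forall y \near x, [/\ U y, `|G x - G y| < e & `|H x - H y| < e].
    have /cvgrPdist_lt/(_ _ e0) Ge := Gc.
    have /cvgrPdist_lt/(_ _ e0) He := Hc.
    by apply: filterS3 (near_open oU Ux) Ge He => y Uy Gy Hy; split.
  by move=> /nbhs_normP[d /= d0 dP]; exists d => // y xy; apply: dP.
(* The parallelogram with sides [h *: u] and [h *: v] at [x] lies in the ball
   of radius [d]. *)
pose h := d / (`|u| + `|v| + 1).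
have n0 : 0 < `|u| + `|v| + 1 by rewrite ltr_wpDl // addr_ge0.
have h0 : 0 < h by rewrite divr_gt0.
have hball u' v' a b : `|u'| + `|v'| = `|u| + `|v| ->
    0 <= a <= h -> 0 <= b <= h -> `|x - (x + a *: u' + b *: v')| < d.
  move=> uv /andP[a0 ah] /andP[b0 bh].
  rewrite -addrA opprD addrA subrr sub0r normrN.
  apply: (le_lt_trans (ler_normD _ _)); rewrite !normrZ !ger0_norm //.
  apply: (@le_lt_trans _ _ (h * (`|u'| + `|v'|))).
    by rewrite mulrDr lerD // ler_wpM2r.
  by rewrite uv /h -mulrA gtr_pMr // mulrC ltr_pdivrMr // mul1r ltrDl.
have [a [b [ah bh E1]]] := second_difference h0 df (proj1 (ddf u))
  (fun a b ah bh => let: And3 p _ _ :=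
    dball _ (hball u v a b erefl ah bh) in p).
have [b' [a' [bh' ah' E2]]] := second_difference h0 df (proj1 (ddf v))
  (fun a b ah bh => let: And3 p _ _ :=
    dball _ (hball v u a b (addrC _ _) ah bh) in p).
have E : G (x + a *: u + b *: v) = H (x + b' *: v + a' *: u).
  have hn : h != 0 by rewrite gt_eqF.
  apply: (mulIf hn); apply: (mulIf hn).
  rewrite -[LHS]E1 -[RHS]E2 [x + h *: v + _]addrAC.
  congr (_ + f x); exact: addrAC.
have [_ G1 _] := dball _ (hball u v a b erefl ah bh).
have [_ _ H1] := dball _ (hball v u b' a' (addrC _ _) bh' ah').
have GHE : G x - H x = (G x - G (x + a *: u + b *: v))
    + (H (x + b' *: v + a' *: u) - H x) by rewrite E addrA subrK.
have := ltrD G1 H1.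
rewrite [X in _ + X]distrC => /(le_lt_trans (ler_normD _ _)).
by rewrite -GHE /e -splitr ltxx.
Qed.

(** For maps into a space of row vectors the mean value theorem applies to the
coordinates only, to which the symmetry is reduced. *)
Lemma diff_diff_sym (k : nat) (f : 'rV[R]_m -> 'rV[R]_k) x u v :
  smooth_on U f -> U x ->
  'd (fun y => 'd f y u) x v = 'd (fun y => 'd f y v) x u.
Proof.
move=> fs Ux; apply/rowP => j.
have df y : U y -> differentiable f y := smooth_on_differentiable fs.
have fj : Cn_on 2 U (fun y => f y 0 j : R^o) := smooth_on_entry oU 0 j fs 2.
have E w w' : 'd (fun y => 'd f y w) x w' 0 j =
    'd (fun y => 'd (fun z => f z 0 j : R^o) y w : R^o) x w'.
  have dw : differentiable (fun y => 'd f y w) x.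
    exact: smooth_on_differentiable (smooth_on_diff w fs) Ux.
  rewrite -(is_diffE (is_diff_entry 0 j (differentiableP dw)) w').
  apply/esym; apply: (is_diffE (is_diff_near _ (differentiableP _))) => //.
  - apply: filterS (near_open oU Ux) => y Uy.
    exact: esym (is_diffE (is_diff_entry 0 j (differentiableP (df y Uy))) w).
  - exact: is_diff_differentiable (is_diff_entry 0 j (differentiableP dw)).
by rewrite !E; exact: diff_diff_sym_scalar.
Qed.

End Young.

(** * Differentials of maps on a manifold *)

(** The two terms are the second derivative of [F] with [Z] frozen at [x], which
is symmetric, and the derivative of [F] along that of [Z], which makes up the
bracket. *)
Lemma is_diff_diff_field (R : realType) (m : nat) (U : set 'rV[R]_m)
    (V : normedModType R) (F : 'rV[R]_m -> V) (Z : 'rV[R]_m -> 'rV[R]_m) x :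
  open U -> smooth_on U F -> smooth_on U Z -> U x ->
  is_diff x (fun y => 'd F y (Z y))
    (fun v => 'd (fun y => 'd F y (Z x)) x v + 'd F x ('d Z x v)).
Proof.
move=> oU Fs Zs Ux.
have dFe j : is_diff x (fun y => 'd F y (delta_mx 0 j))
    ('d (fun y => 'd F y (delta_mx 0 j)) x).
  exact: differentiableP (smooth_on_differentiable (smooth_on_diff _ Fs) Ux).
have dZj j := is_diff_entry 0 j
  (differentiableP (smooth_on_differentiable Zs Ux)).
have h := @is_diff_sum _ _ _ _ (index_enum 'I_m) xpredT _ _ x
  (fun j _ => is_diff_scale (dZj j) (dFe j)).
have -> : (fun y => 'd F y (Z y)) =
    (fun y => \sum_j Z y 0 j *: 'd F y (delta_mx 0 j)).
  by apply/funext => y; exact: diff_row_sum.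
have h2 := @is_diff_sum _ _ _ _ (index_enum 'I_m) xpredT _ _ x
  (fun j _ => is_diffZ (Z x 0 j) (dFe j)).
apply: is_diff_eq h _.
apply/funext => v; rewrite big_split /=; congr (_ + _); last first.
  exact/esym/diff_row_sum.
have -> : (fun y => 'd F y (Z x)) =
    (fun y => \sum_j Z x 0 j *: 'd F y (delta_mx 0 j)).
  by apply/funext => y; exact: diff_row_sum.
exact: esym (is_diffE h2 v).
Qed.

Section Charts.
Context {R : realType} {m : nat} {M : manifold R m}.
Implicit Types (c p q : M) (U : set M).

Lemma fwdK_at p : bwd (chart_at p) (fwd (chart_at p) p) = p.
Proof. exact: fwdK (chart_at_dom p). Qed.

Lemma near_bwd c p (P : set M) : dom (chart_at c) p ->
  (\forall q \near p, P q) ->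
  \forall x \near fwd (chart_at c) p, P (bwd (chart_at c) x).
Proof.
move=> cp nP; have := bwd_cont cp; apply.
by rewrite fwdK.
Qed.

Lemma open_fwd c U : open U ->
  open (fwd (chart_at c) @` (U `&` dom (chart_at c))).
Proof.
move=> oU; rewrite openE => _ [p [Up cp] <-].
have h1 := near_bwd cp (near_open (openI oU (open_dom (chart_at c)))
  (conj Up cp)).
have h2 : \forall x \near fwd (chart_at c) p,
  (fwd (chart_at c) @` dom (chart_at c)) x.
  by apply: near_open; [exact: open_cod|exists p].
apply: filterS2 h1 h2 => x /= Ux [q cq qx]; exists q => //.
by move: Ux; rewrite -qx fwdK.
Qed.

(** Differentiability in the preferred chart at [p], with the value of the
differential, so that differentials are computed by inference as for
[is_diff]. *)
Definition is_mdiff {V : normedModType R} p (f : M -> V) (df : 'rV[R]_m -> V) :=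
  is_diff (fwd (chart_at p) p) (f \o bwd (chart_at p)) df.

Section Rules.
Variables (V : normedModType R) (p : M).
Implicit Types f g : M -> V.

Lemma mdiffE f df : is_mdiff p f df -> forall v, mdiff f p v = df v.
Proof. exact: is_diffE. Qed.

Lemma is_mdiff_near f g df : (\forall q \near p, f q = g q) ->
  is_mdiff p f df -> is_mdiff p g df.
Proof. move=> fg; apply: is_diff_near; exact: near_bwd (chart_at_dom p) fg. Qed.

Lemma is_mdiff_scale (f df : _ -> R^o) g dg : is_mdiff p f df ->
  is_mdiff p g dg ->
  is_mdiff p (fun q => f q *: g q) (fun v => f p *: dg v + df v *: g p).
Proof.
by move=> hf hg; have := is_diff_scale hf hg; rewrite /= fwdK_at.
Qed.

Lemma is_mdiff_sum (I : Type) (r : seq I) (f : I -> M -> V) df :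
  (forall i, is_mdiff p (f i) (df i)) ->
  is_mdiff p (fun q => \sum_(i <- r) f i q) (fun v => \sum_(i <- r) df i v).
Proof.
move=> h; exact: (@is_diff_sum _ _ _ _ r xpredT (fun i => f i \o _) _ _
  (fun i _ => h i)).
Qed.

End Rules.

Lemma is_mdiff_entry p (k l : nat) (f : M -> 'M[R]_(k, l)) df i j :
  is_mdiff p f df -> is_mdiff p (fun q => f q i j : R^o) (fun v => df v i j).
Proof. exact: is_diff_entry. Qed.

Lemma is_mdiff_dot p (k : nat) (f g : M -> 'rV[R]_k) df dg :
  is_mdiff p f df -> is_mdiff p g dg ->
  is_mdiff p (fun q => dot (f q) (g q) : R^o)
    (fun v => dot (f p) (dg v) + dot (df v) (g p)).
Proof.
by move=> hf hg; have := is_diff_dot hf hg; rewrite /= fwdK_at.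
Qed.

Lemma msmooth_is_mdiff (V : normedModType R) U (f : M -> V) p :
  msmooth_on U f -> U p -> is_mdiff p f (mdiff f p).
Proof.
move=> fs Up; apply: differentiableP; apply: smooth_on_differentiable (fs p) _.
by exists p => //; split=> //; exact: chart_at_dom.
Qed.

Lemma chart_change_differentiable c p : dom (chart_at c) p ->
  is_mdiff p (fwd (chart_at c)) (mdiff (fwd (chart_at c)) p).
Proof.
move=> cp; apply: differentiableP.
apply: smooth_on_differentiable (chart_compat p c) _.
by exists p => //; split=> //; exact: chart_at_dom.
Qed.

(** A tangent vector at [p] is given by its components in the chart at [p]. *)
Lemma mdiff_fwd p v : mdiff (fwd (chart_at p)) p v = v.
Proof.
suff h : is_diff (fwd (chart_at p) p) (fwd (chart_at p) \o bwd (chart_at p)) id.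
  exact: is_diffE h v.
apply: is_diff_near (is_diff_id _).
have : \forall x \near fwd (chart_at p) p,
  (fwd (chart_at p) @` dom (chart_at p)) x.
  by apply: near_open; [exact: open_cod|exists p => //; exact: chart_at_dom].
by apply: filterS => x [q cq <-] /=; rewrite fwdK.
Qed.

(** Chain rule: in the coordinates of a fixed chart the differential of [f]
is that of one map, although [mdiff] uses a chart which varies with the
point. *)
Lemma mdiff_chart (V : normedModType R) (f : M -> V) c p v :
  dom (chart_at c) p ->
  differentiable (f \o bwd (chart_at c)) (fwd (chart_at c) p) ->
  mdiff f p v =
  'd (f \o bwd (chart_at c)) (fwd (chart_at c) p)
    (mdiff (fwd (chart_at c)) p v).
Proof.
move=> cp df.
have h1 := chart_change_differentiable cp.
have h2 : is_diff ((fwd (chart_at c) \o bwd (chart_at p)) (fwd (chart_at p) p))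
   (f \o bwd (chart_at c)) ('d (f \o bwd (chart_at c)) (fwd (chart_at c) p)).
  by rewrite /= fwdK_at; exact: differentiableP.
apply: (is_diffE (is_diff_near _ (is_diff_comp h1 h2))).
have := near_bwd (chart_at_dom p) (near_open (open_dom (chart_at c)) cp).
by apply: filterS => x /= cx; rewrite fwdK.
Qed.

Section Smooth.
Variables (U : set M) (oU : open U).

Lemma msmooth_on_eq (V : normedModType R) (f g : M -> V) :
  (forall q, U q -> f q = g q) -> msmooth_on U f -> msmooth_on U g.
Proof.
move=> fg fs c; apply: smooth_on_eq (fs c); first exact: open_fwd.
by move=> _ [q [Uq cq] <-] /=; rewrite fwdK //; exact: fg.
Qed.

Lemma msmooth_on_cst (V : normedModType R) (a : V) : msmooth_on U (cst a).
Proof. by move=> c; apply: (smooth_on_cst _ a). Qed.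

Lemma msmooth_onD (V : normedModType R) (f g : M -> V) :
  msmooth_on U f -> msmooth_on U g -> msmooth_on U (fun q => f q + g q).
Proof.
by move=> fs gs c; apply: (smooth_onD _ (fs c) (gs c)); exact: open_fwd.
Qed.

Lemma msmooth_on_scale (V : normedModType R) (f : M -> R^o) (g : M -> V) :
  msmooth_on U f -> msmooth_on U g -> msmooth_on U (fun q => f q *: g q).
Proof.
by move=> fs gs c; apply: (smooth_on_scale _ (fs c) (gs c)); exact: open_fwd.
Qed.

Lemma msmooth_on_entry (k l : nat) (f : M -> 'M[R]_(k, l)) i j :
  msmooth_on U f -> msmooth_on U (fun q => f q i j : R^o).
Proof.
by move=> fs c; apply: (smooth_on_entry _ _ _ (fs c)); exact: open_fwd.
Qed.

Lemma field_in_chart (X : M -> 'rV[R]_m) c : field_on U X ->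
  smooth_on (fwd (chart_at c) @` (U `&` dom (chart_at c)))
    (fun x => mdiff (fwd (chart_at c)) (bwd (chart_at c) x)
      (X (bwd (chart_at c) x))).
Proof.
by move=> /(_ c c); rewrite -setIA setIid.
Qed.

Lemma mdiff_field_chart (V : normedModType R) (f : M -> V)
    (X : M -> 'rV[R]_m) c x :
  msmooth_on U f -> (fwd (chart_at c) @` (U `&` dom (chart_at c))) x ->
  mdiff f (bwd (chart_at c) x) (X (bwd (chart_at c) x)) =
  'd (f \o bwd (chart_at c)) x
    (mdiff (fwd (chart_at c)) (bwd (chart_at c) x) (X (bwd (chart_at c) x))).
Proof.
move=> fs [q [Uq cq] <-]; rewrite fwdK // (mdiff_chart _ cq) //.
by apply: smooth_on_differentiable (fs c) _; exists q.
Qed.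

Lemma msmooth_on_mdiff (V : normedModType R) (f : M -> V) (X : M -> 'rV[R]_m) :
  msmooth_on U f -> field_on U X -> msmooth_on U (fun q => mdiff f q (X q)).
Proof.
move=> fs Xs c; have oc := open_fwd (c := c) oU.
have h := smooth_on_diff_field oc (fs c) (field_in_chart c Xs).
apply: (smooth_on_eq oc _ h).
by move=> x xU /=; rewrite [RHS](mdiff_field_chart _ fs xU).
Qed.

(** In the chart at [p] the terms with second derivatives of [f] cancel by
symmetry; the others form the bracket, which is defined in that same chart. *)
Lemma mdiff_lie (k : nat) (f : M -> 'rV[R]_k) (X Y : M -> 'rV[R]_m) p :
  msmooth_on U f -> field_on U X -> field_on U Y -> U p ->
  mdiff (fun q => mdiff f q (Y q)) p (X p)
  - mdiff (fun q => mdiff f q (X q)) p (Y p)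
  = mdiff f p (lie X Y p).
Proof.
move=> fs Xs Ys Up; have oc := open_fwd (c := p) oU.
set c := chart_at p in oc *; set x0 := fwd c p.
have Ux0 : (fwd c @` (U `&` dom c)) x0.
  by exists p => //; split=> //; exact: chart_at_dom.
(* By symmetry the second derivatives are the same for [Y] in the direction
   [X p] and for [X] in the direction [Y p]. *)
have key (Z : M -> 'rV[R]_m) v : field_on U Z ->
    mdiff (fun q => mdiff f q (Z q)) p v =
    'd (fun y => 'd (f \o bwd c) y (Z p)) x0 v
    + mdiff f p (mdiff (fun q => mdiff (fwd c) q (Z q)) p v).
  move=> Zs; have Zc := field_in_chart p Zs.
  have := is_diff_diff_field oc (fs p) Zc Ux0.
  rewrite /= fwdK_at mdiff_fwd => h; apply: (is_diffE (is_diff_near _ h)).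
  apply: filterS (near_open oc Ux0) => x xU.
  by rewrite [RHS](mdiff_field_chart _ fs xU).
apply: etrans (congr2 (fun a b => a - b) (key Y (X p) Ys) (key X (Y p) Xs)) _.
have S := diff_diff_sym oc (Y p) (X p) (fs p) Ux0.
apply: etrans (congr1 (fun a => a + _ - _) S) _.
rewrite [X in X - _]addrC addrKA.
exact: esym (linearB ('d (f \o bwd c) x0) _ _).
Qed.

End Smooth.

End Charts.

(** * The Levi-Civita connection of the sphere *)

Section Dot.
Variables (R : realType) (k : nat).
Implicit Types (u v w : 'rV[R]_k) (a : R).

Lemma dotC u v : dot u v = dot v u.
Proof. by apply: eq_bigr => i _; rewrite mulrC. Qed.

Lemma dotDl u v w : dot (u + v) w = dot u w + dot v w.
Proof. by rewrite !dot_mulmx mulmxDl mxE. Qed.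

Lemma dotZl a u v : dot (a *: u) v = a * dot u v.
Proof. by rewrite !dot_mulmx -scalemxAl mxE. Qed.

Lemma dotNl u v : dot (- u) v = - dot u v.
Proof. by rewrite -scaleN1r dotZl mulN1r. Qed.

Lemma dotBl u v w : dot (u - v) w = dot u w - dot v w.
Proof. by rewrite dotDl dotNl. Qed.

Lemma dot0l v : dot 0 v = 0.
Proof. by rewrite -(scale0r v) dotZl mul0r. Qed.

Lemma dotDr u v w : dot u (v + w) = dot u v + dot u w.
Proof. by rewrite ![dot u _]dotC dotDl. Qed.

Lemma dotZr a u v : dot u (a *: v) = a * dot u v.
Proof. by rewrite ![dot u _]dotC dotZl. Qed.

Lemma dotNr u v : dot u (- v) = - dot u v.
Proof. by rewrite ![dot u _]dotC dotNl. Qed.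

Lemma dotBr u v w : dot u (v - w) = dot u v - dot u w.
Proof. by rewrite dotDr dotNr. Qed.

Lemma dot_suml I (r : seq I) (F : I -> 'rV[R]_k) v :
  dot (\sum_(i <- r) F i) v = \sum_(i <- r) dot (F i) v.
Proof.
elim: r => [|i r ih]; first by rewrite !big_nil dot0l.
by rewrite !big_cons dotDl ih.
Qed.

Lemma dot_eq0 u : dot u u = 0 -> u = 0.
Proof.
move=> /eqP; rewrite psumr_eq0 => [|i _]; last by rewrite -expr2 sqr_ge0.
move=> /allP u0; apply/rowP => i; rewrite mxE.
by have := u0 i (mem_index_enum i); rewrite mulf_eq0 orbb => /eqP.
Qed.

(** Orthogonal projection onto the orthogonal complement of a unit vector,
that is, onto the tangent space of the sphere. *)
Definition orthproj (x w : 'rV[R]_k) : 'rV[R]_k := w - dot w x *: x.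

Lemma orthproj_orth x w : dot x x = 1 -> dot (orthproj x w) x = 0.
Proof. by move=> xx; rewrite /orthproj dotBl dotZl xx mulr1 subrr. Qed.

Lemma orthproj_id x w : dot w x = 0 -> orthproj x w = w.
Proof. by move=> wx; rewrite /orthproj wx scale0r subr0. Qed.

End Dot.

Section Sphere.
Variables (R : realType) (k : nat).
Implicit Types (u v w q : 'rV[R]_k).

Lemma smooth_orthproj w : smooth_on setT (fun x => orthproj x w).
Proof.
have oT : open [set: 'rV[R]_k] := openT.
apply: (smooth_onD oT); first exact: smooth_on_cst.
have h := smooth_on_scale oT
  (smooth_on_dot oT (smooth_on_cst _ (- w)) (smooth_on_id _))
  (smooth_on_id _).
by apply: (smooth_on_eq oT _ h) => x _ /=; rewrite dotNl scaleNr.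
Qed.

Lemma sphere_field_orthproj w : sphere_field setT (fun x => orthproj x w).
Proof.
split; [exact: openT|exact: smooth_orthproj|].
by move=> x _ xx; exact: orthproj_orth.
Qed.

Lemma is_diff_orthproj w q :
  is_diff q (fun x => orthproj x w) (fun v => - (dot w q *: v + dot w v *: q)).
Proof.
have h1 := is_diff_dot (is_diff_cst w q) (is_diff_id q).
have h2 := is_diffB (is_diff_cst w q) (is_diff_scale h1 (is_diff_id q)).
apply: is_diff_eq h2 _; apply/funext => v /=.
by rewrite !fctE /= sub0r dot0l addr0.
Qed.

Section LeviCivita.
Variable D : ('rV[R]_k -> 'rV[R]_k) -> 'rV[R]_k -> 'rV[R]_k -> 'rV[R]_k.
Hypothesis hD : sphere_levi_civita D.

(** Uniqueness of the Levi-Civita connection on fields which span all tangent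
spaces. By compatibility with the metric and vanishing of the torsion, its
difference with the projected ambient derivative is a trilinear form which is
symmetric in its first two arguments and antisymmetric in the last two; such a
form is zero. *)
Lemma levi_civita_orthproj w q v : sphere q -> dot v q = 0 ->
  D (fun x => orthproj x w) q v = - dot w q *: v.
Proof.
move=> qq vq; have [cD mD tD] := hD.
(* For [v] tangent at [q], the projected ambient derivative of the field is
   [- dot w q *: v]. *)
pose S w v := D (fun x => orthproj x w) q v + dot w q *: v.
have St w' v' : dot v' q = 0 -> dot (S w' v') q = 0.
  move=> v'q; have [tan _ _ _ _] := cD _ _ (sphere_field_orthproj w').
  have [Z [_ _ Zt] ZE] := tan _ (sphere_field_orthproj v').
  have := Zt q I qq; rewrite (ZE q I qq) /= (orthproj_id v'q) => Dq.
  by rewrite /S dotDl Dq dotZl v'q mulr0 addr0.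
have Sm w' u' v' : dot v' q = 0 ->
    dot (S w' v') (orthproj q u') + dot (orthproj q w') (S u' v') = 0.
  move=> v'q.
  have := mD _ _ _ (sphere_field_orthproj w')
    (sphere_field_orthproj u') q v' I qq v'q.
  rewrite (is_diffE (is_diff_dot (is_diff_orthproj w' q)
    (is_diff_orthproj u' q))).
  rewrite /S; have := orthproj_orth w' qq; have := orthproj_orth u' qq.
  move: (orthproj q w') (orthproj q u') (D _ _ _) (D _ _ _) => a b da db bq aq.
  rewrite !(dotDl, dotDr, dotNl, dotNr, dotZl, dotZr).
  rewrite aq [dot q b]dotC bq !mulr0 !addr0 => E.
  by lra.
have Ss w' u' : S w' (orthproj q u') = S u' (orthproj q w').
  have T := tD _ _ _ (sphere_field_orthproj u')
    (sphere_field_orthproj w') q I qq.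
  have E := congr2 (fun a b => a - b)
    (is_diffE (is_diff_orthproj w' q) (orthproj q u'))
    (is_diffE (is_diff_orthproj u' q) (orthproj q w')).
  have {T E} := etrans (congr1 (fun a => _ - a) (esym E)) T.
  have -> : dot w' (orthproj q u') = dot u' (orthproj q w').
    by rewrite /orthproj !dotBr !dotZr [dot w' u']dotC [dot u' q * _]mulrC.
  rewrite /S; move: (orthproj q w') (orthproj q u') (D _ _ _) (D _ _ _).
  move=> a b da db /rowP E; apply/rowP => i.
  by have := E i; rewrite !mxE; lra.
pose B v' w' u' := dot (S w' (orthproj q v')) (orthproj q u').
have Bs a b c : B a b c = B b a c by rewrite /B Ss.
have Ba a b c : B a b c = - B a c b.
  apply/eqP; rewrite -addr_eq0 /B [X in _ + X]dotC; apply/eqP; apply: Sm.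
  exact: orthproj_orth.
have B0 a b c : B a b c = 0.
  have : B a b c = - B a b c.
    by rewrite {1}Bs Ba Bs Ba opprK Bs Ba.
  by move=> /eqP; rewrite -addr_eq0 -mulr2n mulrn_eq0 => /eqP.
have : S w v = 0.
  apply: dot_eq0; have := B0 v w (S w v).
  by rewrite /B (orthproj_id vq) (orthproj_id (St w v vq)).
by rewrite /S => /eqP; rewrite addr_eq0 scaleNr => /eqP.
Qed.

End LeviCivita.
End Sphere.

(** * The pullback connection *)

Section PullbackSmooth.
Context {R : realType} {m : nat} {M : manifold R m}.

Lemma Cn_on_sub (V : normedModType R) (l i : nat) (A B : set 'rV[R]_l)
    (f : 'rV[R]_l -> V) :
  A `<=` B -> Cn_on i B f -> Cn_on i A f.
Proof.
move=> AB; elim: i f => [|i ih] f /=; first by move=> fc x /AB; exact: fc.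
by move=> [fd fC]; split=> [x /AB|v]; [exact: fd|exact/ih/fC].
Qed.

Lemma msmooth_on_sub (V : normedModType R) (A B : set M) (f : M -> V) :
  A `<=` B -> msmooth_on B f -> msmooth_on A f.
Proof.
move=> AB fs c i; apply: Cn_on_sub (fs c i) => _ [p [Ap cp] <-].
by exists p => //; split=> //; exact: AB.
Qed.

Lemma msmooth_on_orthproj (k : nat) (U : set M) (g : M -> 'rV[R]_k) w :
  open U -> msmooth_on U g -> msmooth_on U (fun q => orthproj (g q) w).
Proof.
move=> oU gs; apply: (msmooth_onD oU (msmooth_on_cst U w)).
have h : msmooth_on U (fun q => dot (- w) (g q) : R^o).
  move=> c; have oc := open_fwd (c := c) oU.
  exact: (smooth_on_dot oc (smooth_on_cst _ (- w)) (gs c)).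
apply: (msmooth_on_eq oU _ (msmooth_on_scale oU h gs)) => q _.
by rewrite dotNl scaleNr.
Qed.

End PullbackSmooth.

Section PullbackConnection.
Context {R : realType} {n : nat} {Mt : weitzenbock R n.+1}.
Context {M : hypersurface Mt}.
Variables (g : M -> 'rV[R]_n.+1) (U : set M).
Variable D : ('rV[R]_n.+1 -> 'rV[R]_n.+1) -> 'rV[R]_n.+1 -> 'rV[R]_n.+1 ->
  'rV[R]_n.+1.
Variable gD : (M -> 'rV[R]_n.+1) -> M -> 'rV[R]_n -> 'rV[R]_n.+1.
Hypotheses (oU : open U) (gs : msmooth_on U g) (g1 : forall p, sphere (g p)).
Hypotheses (hD : sphere_levi_civita D) (hgD : pullback_connection g D gD).

Lemma pullback_section_sum I (r : seq I) (F : I -> M -> 'rV[R]_n.+1) :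
  (forall i, pullback_section g U (F i)) ->
  pullback_section g U (fun q => \sum_(i <- r) F i q).
Proof.
move=> Fs; split=> //; last first.
  by move=> p Up; rewrite dot_suml big1 // => i _; have [_ _] := Fs i; apply.
elim: r => [|i r ih].
  by apply: (msmooth_on_eq oU _ (msmooth_on_cst U 0)) => q _; rewrite big_nil.
have [_ Fi _] := Fs i.
by apply: (msmooth_on_eq oU _ (msmooth_onD oU Fi ih)) => q _; rewrite big_cons.
Qed.

Lemma pullback_connection_sum I (r : seq I) (F : I -> M -> 'rV[R]_n.+1) p v :
  (forall i, pullback_section g U (F i)) -> U p ->
  gD (fun q => \sum_(i <- r) F i q) p v = \sum_(i <- r) gD (F i) p v.
Proof.
move=> Fs Up; elim: r => [|i r ih].
  pose O := fun q : M => \sum_(i <- [::]) F i q.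
  have Os : pullback_section g U O := pullback_section_sum [::] Fs.
  have [_ _ locO addO _] := hgD.1 U O Os.
  have [_ sO tO] := Os.
  have OO : pullback_section g U (fun q => O q + O q).
    split=> //; first exact: msmooth_onD.
    by move=> q Uq; rewrite dotDl tO // addr0.
  (* The zero section is its own double. *)
  have E : gD O p v = gD O p v + gD O p v.
    rewrite -(addO _ Os p v Up); apply/esym.
    apply: (locO _ OO) => // q _.
    by rewrite /O big_nil addr0.
  rewrite big_nil; apply/esym; move/eqP: E.
  by rewrite -subr_eq0 opprD addrA subrr sub0r oppr_eq0 => /eqP.
have Rs := pullback_section_sum r Fs.
have Cs := pullback_section_sum (i :: r) Fs.
have [_ _ loc _ _] := hgD.1 U _ Cs.
have [_ _ _ add _] := hgD.1 U _ (Fs i).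
rewrite big_cons -ih -(add _ Rs p v Up).
apply/esym; apply: loc => //; last by move=> q Uq; rewrite big_cons.
have [_ sC tC] := Cs; split=> //.
  by apply: (msmooth_on_eq oU _ sC) => q _; rewrite big_cons.
by move=> q Uq; rewrite -(tC q Uq) big_cons.
Qed.

(** A section is the combination of the pulled back fields
[fun x => orthproj x e_a], the coefficients being its own coordinates; so the
Leibniz rule and the value of the Levi-Civita connection on these fields
determine the pullback connection, which is the projected derivative. *)
Lemma pullback_connectionE V p v : pullback_section g U V -> U p ->
  dot (mdiff g p v) (g p) = 0 -> gD V p v = orthproj (g p) (mdiff V p v).
Proof.
move=> Vs Up tg; have [_ sV tV] := Vs.
pose e (a : 'I_n.+1) : 'rV[R]_n.+1 := delta_mx 0 a.
pose Y a := fun q : M => orthproj (g q) (e a).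
pose c a := fun q : M => V q 0 a : R^o.
have VE q : U q -> V q = \sum_a c a q *: Y a q.
  move=> Uq; rewrite /Y /orthproj;
    under eq_bigr do rewrite scalerBr scalerA -dotZl.
  by rewrite sumrB -scaler_suml -dot_suml -row_sum_delta tV // scale0r subr0.
have sc a : msmooth_on U (c a) := msmooth_on_entry oU 0 a sV.
have sY a : msmooth_on U (Y a) := msmooth_on_orthproj (e a) oU gs.
have Ys a : pullback_section g U (Y a).
  by split=> // q Uq; exact: orthproj_orth (g1 q).
have cYs a : pullback_section g U (fun q => c a q *: Y a q).
  split=> //; first exact: msmooth_on_scale.
  by move=> q Uq; have [_ _ tY] := Ys a; rewrite dotZl tY // mulr0.
have Ss := pullback_section_sum (index_enum _) cYs.
have [_ _ loc _ _] := hgD.1 U _ Ss.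
rewrite (loc _ Vs VE p v Up) (pullback_connection_sum _ _ cYs Up).
have dV := msmooth_is_mdiff sV Up.
have step a : gD (fun q => c a q *: Y a q) p v =
    mdiff V p v 0 a *: Y a p - dot (V p 0 a *: e a) (g p) *: mdiff g p v.
  have [_ _ _ _ leib] := hgD.1 U _ (Ys a).
  rewrite (leib _ (sc a) p v Up) (mdiffE (is_mdiff_entry 0 a dV)).
  have -> : gD (Y a) p v = D (fun x => orthproj x (e a)) (g p) (mdiff g p v).
    exact: (hgD.2 _ _ (sphere_field_orthproj (e a)) p v I).
  by rewrite (levi_civita_orthproj hD _ (g1 p) tg) scalerA mulrN scaleNr dotZl.
under eq_bigr do rewrite step.
rewrite sumrB -scaler_suml -dot_suml -row_sum_delta tV // scale0r subr0.
rewrite /Y /orthproj; under eq_bigr do rewrite scalerBr scalerA -dotZl.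
by rewrite sumrB -scaler_suml -dot_suml -row_sum_delta.
Qed.

End PullbackConnection.

(** * Hypersurfaces in the parallel frame *)

Section ChartChange.
Context {R : realType} {m : nat} {M : manifold R m}.

Definition chart_change_mx (c r : M) : 'M[R]_m :=
  lin1_mx ('d (fwd (chart_at c) \o bwd (chart_at r)) (fwd (chart_at r) r)).

Lemma mul_chart_change_mx (c r : M) v :
  v *m chart_change_mx c r = mdiff (fwd (chart_at c)) r v.
Proof. exact: mul_rV_lin1. Qed.

(** The inverse is the matrix of the opposite change of charts. *)
Lemma chart_change_mx_unit (c r : M) :
  dom (chart_at c) r -> chart_change_mx c r \in unitmx.
Proof.
move=> cr.
pose K := lin1_mx ('d (fwd (chart_at r) \o bwd (chart_at c))
  (fwd (chart_at c) r)).
have KE v : v *m K =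
  'd (fwd (chart_at r) \o bwd (chart_at c)) (fwd (chart_at c) r) v.
  exact: mul_rV_lin1.
clearbody K.
suff E : chart_change_mx c r *m K = 1%:M by exact: (mulmx1_unit E).1.
apply/row_matrixP => i; rewrite row_mul rowE mul_chart_change_mx KE.
rewrite row1; apply: etrans (mdiff_fwd r _).
apply/esym; apply: (mdiff_chart _ cr).
apply: smooth_on_differentiable (chart_compat c r) _.
by exists r => //; split=> //; exact: (chart_at_dom r).
Qed.

(** The tangent map is defined in the chart at [f q], which varies with [q];
composing with a change of charts gives the differential in a fixed chart. *)
Lemma tangent_map_chart (k : nat) (M' : manifold R k) (f : M -> M')
    (c : M') (q : M) u :
  smooth_map f -> dom (chart_at c) (f q) ->
  mdiff (fwd (chart_at c) \o f) q u =
  mdiff (fwd (chart_at c)) (f q) (u *m tangent_map f q).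
Proof.
move=> [fc fs] cq.
have tE : u *m tangent_map f q = mdiff (fwd (chart_at (f q)) \o f) q u.
  exact: mul_rV_lin1.
have fd : is_mdiff q (fwd (chart_at (f q)) \o f)
  (mdiff (fwd (chart_at (f q)) \o f) q).
  by apply: msmooth_is_mdiff (fs (f q)) _; exact: chart_at_dom.
have cd := chart_change_differentiable cq.
have cd' : is_diff
    ((fwd (chart_at (f q)) \o f \o bwd (chart_at q)) (fwd (chart_at q) q))
    (fwd (chart_at c) \o bwd (chart_at (f q))) (mdiff (fwd (chart_at c)) (f q)).
  by rewrite /= fwdK_at.
rewrite tE; apply: (is_diffE (is_diff_near _ (is_diff_comp fd cd'))).
have nq : \forall q' \near q, dom (chart_at (f q)) (f q').
  by apply: (fc q); apply: near_open; [exact: open_dom|exact: chart_at_dom].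
by apply: filterS (near_bwd (chart_at_dom q) nq) => x /= dx; rewrite fwdK.
Qed.

End ChartChange.

Section Hypersurface.
Context {R : realType} {n : nat} {Mt : weitzenbock R n.+1}.
Context {M : hypersurface Mt}.
Implicit Types (p q : M) (Y : M -> 'rV[R]_n).

(** The image of a tangent field under the identification of the tangent spaces
with subspaces of the fixed space [R^(n+1)]. *)
Definition coef_field Y q : 'rV[R]_n.+1 := Y q *m phi_mx q.

Lemma frame_mx_unit (r : Mt) : frame_mx r \in unitmx.
Proof. exact: wframe_basis. Qed.

Lemma phi_mx_free p : row_free (phi_mx p).
Proof.
have [_ free _ _] := emb_embedding M.
rewrite /row_free /phi_mx mxrankMfree; first exact: free.
by rewrite row_free_unit unitmx_inv frame_mx_unit.
Qed.

Lemma coef_push p u : coef (emb M p) (u *m demb p) = u *m phi_mx p.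
Proof. by rewrite /coef /phi_mx mulmxA. Qed.

Lemma hmetricE p u v : hmetric p u v = dot (u *m phi_mx p) (v *m phi_mx p).
Proof. by rewrite /hmetric /wmetric !coef_push. Qed.

Lemma coef_wnabla Y p v :
  coef (emb M p) (wnabla (emb M) (push Y) p v) = mdiff (coef_field Y) p v.
Proof.
have E : (fun q => coef (emb M q) (push Y q)) = coef_field Y.
  by apply/funext => q; exact: coef_push.
rewrite /wnabla E; exact: (mulmxK (frame_mx_unit _) _).
Qed.

Section Normal.
Variable N : M -> 'rV[R]_n.+1.
Hypothesis hN : unit_normal N.

Lemma gauss_unit p : dot (gauss N p) (gauss N p) = 1.
Proof. by have [_ + _ _] := hN; apply. Qed.

Lemma gauss_orth p u : dot (u *m phi_mx p) (gauss N p) = 0.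
Proof. by rewrite dotC -coef_push; have [_ _ + _] := hN; apply. Qed.

(** The image of [phi_mx p] is orthogonal to a nonzero vector and has
dimension n, so it is the whole hyperplane. *)
Lemma sub_phi_mx p w : dot w (gauss N p) = 0 -> (w <= phi_mx p)%MS.
Proof.
move=> wg; set g := gauss N p.
have gn0 : g != 0.
  apply/eqP => g0; have := gauss_unit p; rewrite -/g g0 dot0l => /eqP.
  by rewrite eq_sym oner_eq0.
have phiK : (phi_mx p <= kermx g^T)%MS.
  rewrite sub_kermx; apply/eqP/row_matrixP => i.
  apply/rowP => j; rewrite ord1 row_mul rowE -dot_mulmx gauss_orth.
  by rewrite !mxE.
have rk : (\rank (kermx g^T) <= \rank (phi_mx p))%N.
  rewrite mxrank_ker mxrank_tr rank_rV gn0 subn1 /=.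
  by have /eqP -> := phi_mx_free p.
have := geq_leqif (mxrank_leqif_sup phiK); rewrite rk => /esym sub.
apply: submx_trans sub; rewrite sub_kermx; apply/eqP.
by apply/rowP => j; rewrite ord1 -dot_mulmx wg mxE.
Qed.

(** The orthogonal projection lies in the image of [phi_mx p] by [sub_phi_mx],
so that the partial inverse in [tangential] is a true inverse on it. *)
Lemma hnabla_coef Y p v :
  hnabla N Y p v *m phi_mx p = orthproj (gauss N p) (mdiff (coef_field Y) p v).
Proof.
rewrite /hnabla /tangential /phi_mx mulmxA.
set w := _ - _.
have wE : w *m invmx (frame_mx (emb M p)) =
    orthproj (gauss N p) (mdiff (coef_field Y) p v).
  by rewrite /w mulmxBl -scalemxAl /wmetric coef_wnabla -coef_wnabla.
rewrite mulmxKpV; first exact: wE.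
have /submxP[D wD] : (orthproj (gauss N p) (mdiff (coef_field Y) p v) <=
  phi_mx p)%MS.
  by apply: sub_phi_mx; exact: orthproj_orth (gauss_unit p).
apply/submxP; exists D; apply: (can_inj (mulmxK (frame_mx_unit (emb M p)))).
rewrite -[w](mulmxKV (frame_mx_unit (emb M p))) wE wD /phi_mx.
by rewrite !mulmxA mulmxKV ?frame_mx_unit.
Qed.

End Normal.

(** In a chart of the ambient manifold both the frame and the pushed forward
field have differentiable components; the coefficients of the latter in the
former are then given by a matrix inverse. *)
Lemma coef_field_is_mdiff (U : set M) Y p : open U -> field_on U Y -> U p ->
  is_mdiff p (coef_field Y) (mdiff (coef_field Y) p).
Proof.
move=> oU Ys Up; have [sm _ _ _] := emb_embedding M; have [ec es] := sm.
pose c := emb M p.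
pose V : set M := emb M @^-1` dom (chart_at c).
have oV : open V by apply: open_comp (open_dom _) => q _; exact: ec.
have oUV := openI oU oV.
have UVp : (U `&` V) p by split=> //; exact: chart_at_dom.
pose f := fwd (chart_at c) \o emb M.
pose Z := fun q => mdiff f q (Y q).
have Zs : msmooth_on (U `&` V) Z.
  apply: msmooth_on_mdiff => //.
    by apply: msmooth_on_sub (es c) => q [].
  move=> d; apply: msmooth_on_sub (Ys d).
  by move=> q [[Uq _] dq].
have Zd := msmooth_is_mdiff Zs UVp.
(* The components of the frame in the fixed chart at [c]. *)
pose Phi (r : Mt) : 'M[R]_n.+1 :=
  \matrix_i mdiff (fwd (chart_at c)) r (wframe i r).
have PhiE r : Phi r = frame_mx r *m chart_change_mx c r.
  by apply/row_matrixP => i; rewrite rowK row_mul rowK mul_chart_change_mx.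
have PhiU r : dom (chart_at c) r -> Phi r \in unitmx.
  by move=> cr; rewrite PhiE unitmx_mul frame_mx_unit chart_change_mx_unit.
have key q : V q -> coef_field Y q *m Phi (emb M q) = Z q.
  move=> Vq; rewrite PhiE /coef_field /phi_mx !mulmxA mulmxKV ?frame_mx_unit //.
  by rewrite mul_chart_change_mx; apply/esym; exact: tangent_map_chart.
have PhiD : differentiable (Phi \o bwd (chart_at c)) (fwd (chart_at c) c).
  apply: differentiable_mx => i j.
  have h := field_in_chart c (wframe_smooth i).
  have hd : differentiable (fun x =>
    mdiff (fwd (chart_at c)) (bwd (chart_at c) x)
      (wframe i (bwd (chart_at c) x))) (fwd (chart_at c) c).
    apply: smooth_on_differentiable h _.
    by exists c => //; split=> //; exact: chart_at_dom.
  have := is_diff_differentiable (is_diff_entry 0 j (differentiableP hd)).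
  by congr (differentiable _ _); apply/funext => x; rewrite /= mxE.
have PhiD' : differentiable (Phi \o emb M \o bwd (chart_at p))
  (fwd (chart_at p) p).
  have fd : differentiable (f \o bwd (chart_at p)) (fwd (chart_at p) p).
    apply: (is_diff_differentiable (msmooth_is_mdiff (es c) _)).
    exact: chart_at_dom.
  have PhiD2 : differentiable (Phi \o bwd (chart_at c))
      ((f \o bwd (chart_at p)) (fwd (chart_at p) p)).
    by rewrite /= fwdK_at.
  have h := differentiableP (differentiable_comp fd PhiD2).
  apply: (is_diff_differentiable (is_diff_near _ h)).
  have := near_bwd (chart_at_dom p) (near_open oV UVp.2).
  by apply: filterS => x /= Vx; rewrite /f /= fwdK.
have Phi_p : (Phi \o emb M \o bwd (chart_at p)) (fwd (chart_at p) p) \in unitmx.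
  by rewrite /= fwdK_at; apply: PhiU; exact: chart_at_dom.
have h := is_diff_mulmx Zd (differentiableP (differentiable_invmx PhiD' Phi_p)).
apply: differentiableP; apply: (is_diff_differentiable (is_diff_near _ h)).
have := near_bwd (chart_at_dom p) (near_open oV UVp.2).
apply: filterS => x /= Vx; rewrite -(key _ Vx) mulmxK //.
exact: PhiU.
Qed.

End Hypersurface.

(** * Divergence in an orthonormal frame *)

(** The components in an orthonormal frame of [div A], for a tensor field with
matrix [a] and derivatives [da i] in the direction of the [i]-th vector of the
frame, where [G i] is the matrix of the connection form in that direction. *)
Definition frame_div (R : realType) (n : nat) (G : 'I_n -> 'M[R]_n)
    (da : 'I_n -> 'M[R]_n) (a : 'M[R]_n) (l : 'I_n) : R :=
  \sum_i (da i i l + (\sum_k a i k * G i k l - \sum_k G i i k * a k l)).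

(** With the matrix of W in an orthonormal frame as [a], the matrix of
H I + 2 W^a. *)
Definition trace_plus_skew (R : realType) (n : nat) (a : 'M[R]_n) : 'M[R]_n :=
  (\tr a)%:M + (a - a^T).

Section FrameDiv.
Variables (R : realType) (n : nat) (G : 'I_n -> 'M[R]_n).

Lemma frame_divD da db a b l :
  frame_div G (fun i => da i + db i) (a + b) l =
  frame_div G da a l + frame_div G db b l.
Proof.
rewrite /frame_div -big_split; apply: eq_bigr => i _ /=.
have -> : \sum_k (a + b) i k * G i k l =
    \sum_k a i k * G i k l + \sum_k b i k * G i k l.
  by rewrite -big_split; apply: eq_bigr => k _; rewrite mxE mulrDl.
have -> : \sum_k G i i k * (a + b) k l =
    \sum_k G i i k * a k l + \sum_k G i i k * b k l.
  by rewrite -big_split; apply: eq_bigr => k _; rewrite mxE mulrDr.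
rewrite mxE; ring.
Qed.

Lemma frame_divN da a l :
  frame_div G (fun i => - da i) (- a) l = - frame_div G da a l.
Proof.
rewrite /frame_div -sumrN; apply: eq_bigr => i _ /=.
have -> : \sum_k (- a) i k * G i k l = - \sum_k a i k * G i k l.
  by rewrite -sumrN; apply: eq_bigr => k _; rewrite mxE mulNr.
have -> : \sum_k G i i k * (- a) k l = - \sum_k G i i k * a k l.
  by rewrite -sumrN; apply: eq_bigr => k _; rewrite mxE mulrN.
rewrite mxE; ring.
Qed.

(** The terms with the connection form cancel in the divergence of c I, which
leaves the gradient of c. *)
Lemma frame_div_scalar (dc : 'I_n -> R) (c : R) l :
  frame_div G (fun i => (dc i)%:M) c%:M l = dc l.
Proof.
rewrite /frame_div (bigD1 l) //= [X in _ + X]big1 => [|i il]; last first.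
  rewrite !mxE (negbTE il) add0r.
  rewrite (bigD1 i) //= [\sum_(k | k != i) _]big1 => [|k ki]; last first.
    by rewrite mxE eq_sym (negbTE ki) mul0r.
  rewrite [\sum_k G i i k * _](bigD1 l) //=.
  rewrite [\sum_(k | k != l) _]big1 => [|k kl].
    by rewrite !mxE !eqxx !addr0 mulrC subrr.
  by rewrite mxE (negbTE kl) mulr0.
rewrite mxE eqxx addr0.
have -> : \sum_k c%:M l k * G l k l = \sum_k G l l k * c%:M k l.
  rewrite (bigD1 l) //= [RHS](bigD1 l) //= !big1; first by rewrite mulrC.
    by move=> k kl; rewrite mxE (negbTE kl) mulr0.
  by move=> k kl; rewrite mxE eq_sym (negbTE kl) mul0r.
by rewrite subrr addr0.
Qed.

(** The trace of the Codazzi equation, which is the second hypothesis: put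
[j = l] and [m = i] and sum over [i]. The terms with the connection form in the
direction [l] cancel, as the trace of a commutator, and the others are those of
the divergence of the transpose. *)
Lemma codazzi_trace (dh : 'I_n -> 'M[R]_n) (h : 'M[R]_n) l :
  (forall i j k, G i j k = - G i k j) ->
  (forall i j m,
    dh i j m + \sum_k h j k * G i k m - (dh j i m + \sum_k h i k * G j k m) =
    \sum_k (G i j k - G j i k) * h k m) ->
  frame_div G (fun i => (dh i)^T) h^T l = \tr (dh l).
Proof.
move=> Ga cod; apply/eqP; rewrite -subr_eq0; apply/eqP.
transitivity (\sum_i ((dh i l i + \sum_k h l k * G i k i
   - (dh l i i + \sum_k h i k * G l k i))
   - \sum_k (G i l k - G l i k) * h k i));
  last by rewrite big1 // => i _; rewrite cod subrr.
have exch : \sum_i \sum_k h i k * G l k i = \sum_i \sum_k G l i k * h k i.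
  rewrite exchange_big /=; apply: eq_bigr => i _; apply: eq_bigr => k _.
  exact: mulrC.
rewrite /frame_div /mxtrace -sumrB.
apply/eqP; rewrite -subr_eq0 -sumrB; apply/eqP.
transitivity (\sum_i (\sum_k h i k * G l k i - \sum_k G l i k * h k i));
  last by rewrite sumrB exch subrr.
apply: eq_bigr => i _.
have -> : \sum_k (G i l k - G l i k) * h k i =
    \sum_k G i l k * h k i - \sum_k G l i k * h k i.
  by rewrite -sumrB; apply: eq_bigr => k _; rewrite mulrBl.
have -> : \sum_k h^T i k * G i k l = - \sum_k G i l k * h k i.
  by rewrite -sumrN; apply: eq_bigr => k _; rewrite mxE Ga mulrN mulrC.
have -> : \sum_k G i i k * h^T k l = - \sum_k h l k * G i k i.
  by rewrite -sumrN; apply: eq_bigr => k _; rewrite mxE Ga mulNr mulrC.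
rewrite mxE; ring.
Qed.

(** The divergences of the trace part and of the transpose cancel. *)
Lemma frame_div_trace_plus_skew (dh : 'I_n -> 'M[R]_n) (h : 'M[R]_n) l :
  (forall i j k, G i j k = - G i k j) ->
  (forall i j m,
    dh i j m + \sum_k h j k * G i k m - (dh j i m + \sum_k h i k * G j k m) =
    \sum_k (G i j k - G j i k) * h k m) ->
  frame_div G (fun i => trace_plus_skew (dh i)) (trace_plus_skew h) l =
  frame_div G dh h l.
Proof.
move=> Ga cod; rewrite /trace_plus_skew.
rewrite (frame_divD (fun i => (\tr (dh i))%:M) (fun i => dh i - (dh i)^T)).
rewrite (frame_divD dh (fun i => - (dh i)^T)) frame_divN.
by rewrite frame_div_scalar (codazzi_trace l Ga cod) addrC subrK.
Qed.

End FrameDiv.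

(** * The tension field of the Gauss map *)

Section Frame.
Context {R : realType} {n : nat} {Mt : weitzenbock R n.+1}.
Context {M : hypersurface Mt}.
Variables (N : M -> 'rV[R]_n.+1) (hN : unit_normal N) (hT : torsion_free N).
Variables (W : M -> 'M[R]_n) (hW : weingarten N W).
Variables (U : set M) (E : 'I_n -> M -> 'rV[R]_n) (hE : on_frame U E).

Let g := gauss N.
(* The vectors of the frame and the derivatives of the Gauss map along them, as
   vectors of R^(n+1); [B q] and [Phi q] have as rows the frame at [q], in the
   chart at [q] and in the parallel frame. *)
Let F j := coef_field (E j).
Let dgE j := fun q => mdiff g q (E j q).
Let B q : 'M[R]_n := \matrix_i E i q.
Let Phi q : 'M[R]_(n, n.+1) := B q *m phi_mx q.

Let oU : open U. Proof. by case: hE. Qed.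
Let Es i : field_on U (E i). Proof. by case: hE. Qed.

Let row_Phi q j : row j (Phi q) = F j q.
Proof. by rewrite row_mul rowK. Qed.

Let Phi_orth q : U q -> Phi q *m (Phi q)^T = 1%:M.
Proof.
move=> Uq; apply/matrixP => i j; have [_ _ on] := hE.
rewrite [RHS]mxE -(on q i j Uq) hmetricE -[E i q *m _]/(F i q)
  -[E j q *m _]/(F j q) -!row_Phi.
by rewrite !mxE; apply: eq_bigr => k _; rewrite !mxE.
Qed.

Let B_unit q : U q -> B q \in unitmx.
Proof.
move=> Uq; have := Phi_orth Uq.
by rewrite /Phi -mulmxA => /mulmx1_unit[].
Qed.

Let F_orth q i j : U q -> dot (F i q) (F j q) = (i == j)%:R.
Proof. by move=> Uq; have [_ _ on] := hE; rewrite -(on q i j Uq) hmetricE. Qed.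

Let F_normal q j : dot (F j q) (g q) = 0.
Proof. exact: gauss_orth. Qed.

(** The vectors [F j q] are an orthonormal basis of the hyperplane orthogonal to
[g q]. *)
Let F_expand q x : U q -> dot x (g q) = 0 -> x = \sum_j dot x (F j q) *: F j q.
Proof.
move=> Uq xg; have /submxP[y ->] := sub_phi_mx hN xg.
have -> : y *m phi_mx q = (y *m invmx (B q)) *m Phi q.
  by rewrite /Phi [RHS]mulmxA mulmxKV // B_unit.
move: (y *m _) => z; rewrite [LHS]mulmx_sum_row; apply: eq_bigr => j _.
rewrite row_Phi; congr (_ *: _); rewrite -row_Phi dot_mulmx tr_row.
by rewrite colE mulmxA -[_ *m Phi q *m _]mulmxA Phi_orth // mulmx1 -colE mxE.
Qed.

Let g_smooth : msmooth_on U g.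
Proof. by have [gs _ _ _] := hN; apply: msmooth_on_sub gs. Qed.

Let dgE_smooth i : msmooth_on U (dgE i).
Proof. exact: msmooth_on_mdiff. Qed.

Let mdiff_g_normal q v : U q -> dot (mdiff g q v) (g q) = 0.
Proof.
move=> Uq; have gd := msmooth_is_mdiff g_smooth Uq.
have h1 := is_mdiff_dot gd gd.
have h2 : is_mdiff q (fun q => dot (g q) (g q) : R^o) (cst 0).
  have -> : (fun q => dot (g q) (g q) : R^o) = cst 1.
    by apply/funext => r; exact: gauss_unit.
  exact: (is_diff_cst (1 : R^o)).
have := etrans (esym (mdiffE h1 v)) (mdiffE h2 v).
by rewrite [dot (g q) _]dotC /=; lra.
Qed.

Let F_diff j p : U p -> is_mdiff p (F j) (mdiff (F j) p).
Proof. by move=> Up; exact: coef_field_is_mdiff oU (Es j) Up. Qed.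

(** The matrix of the Weingarten map in the frame (see [W_frame]), written with
derivatives of the Gauss map, which are smooth. *)
Let h q : 'M[R]_n := \matrix_(i, j) - dot (dgE i q) (F j q).

(** Derivative of <F j, g> = 0 along [E i]. *)
Let h_wnabla q i j : U q -> h q i j = dot (g q) (mdiff (F j) q (E i q)).
Proof.
move=> Uq; rewrite mxE.
have h1 := is_mdiff_dot (F_diff j Uq) (msmooth_is_mdiff g_smooth Uq).
have h2 : is_mdiff q (fun q => dot (F j q) (g q) : R^o) (cst 0).
  have -> : (fun q => dot (F j q) (g q) : R^o) = cst 0.
    by apply/funext => r; exact: F_normal.
  exact: (is_diff_cst (0 : R^o)).
have h3 := etrans (esym (mdiffE h1 (E i q))) (mdiffE h2 (E i q)).
apply: (etrans (congr1 -%R (dotC _ _))); apply/esym/(etrans (dotC _ _)).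
by apply/eqP; rewrite -addr_eq0 addrC; apply/eqP.
Qed.

(** The relation dg = - phi W: both sides have the same components in the basis
[F j q] by the definition of the Weingarten map. *)
Let W_frame q : U q -> B q *m W q = h q *m B q.
Proof.
move=> Uq; suff : B q *m W q *m phi_mx q = h q *m Phi q.
  by rewrite /Phi mulmxA => /(row_free_inj (phi_mx_free q)).
apply/row_matrixP => i; rewrite !row_mul rowK.
rewrite [LHS](F_expand Uq) ?gauss_orth // [RHS]mulmx_sum_row.
apply: eq_bigr => j _; rewrite row_Phi; congr (_ *: _).
have := hW oU (Es i) (Es j) Uq; rewrite hmetricE => ->.
by rewrite /wmetric coef_wnabla mxE h_wnabla.
Qed.

Let tr_W q : U q -> \tr (W q) = \tr (h q).
Proof.
move=> Uq; have Bu := B_unit Uq.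
have -> : h q = B q *m W q *m invmx (B q) by rewrite W_frame // mulmxK.
by rewrite mxtrace_mulC mulmxA mulVmx // mul1mx.
Qed.

(** As the frame is orthonormal, the adjoint has the transposed matrix. *)
Let adjoint_W q : U q -> B q *m adjoint q (W q) = (h q)^T *m B q.
Proof.
move=> Uq; have Bu := B_unit Uq.
have BtU : (B q)^T \in unitmx by rewrite unitmx_tr.
have BGB : B q *m gram q *m (B q)^T = 1%:M.
  rewrite -(Phi_orth Uq) /gram /Phi; move: (B q) (phi_mx q) => b f.
  by rewrite trmx_mul !mulmxA.
have Gi : invmx (gram q) = (B q)^T *m B q.
  have GU : gram q \in unitmx.
    by have := (mulmx1_unit BGB).1; rewrite unitmx_mul => /andP[].
  have : gram q *m ((B q)^T *m B q) = 1%:M.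
    by rewrite mulmxA; apply: mulmx1C; rewrite mulmxA.
  by move=> /(congr1 (mulmx (invmx (gram q)))); rewrite mulKmx // mulmx1.
have BG : B q *m gram q = invmx (B q)^T.
  by rewrite -[LHS](mulmxK BtU) BGB mul1mx.
rewrite /adjoint Gi; move: (gram q) BG => Gm BG; rewrite !mulmxA BG.
congr (_ *m _).
have := congr1 trmx (W_frame Uq); rewrite !trmx_mul => WB.
by rewrite -mulmxA WB mulmxA mulVmx // mul1mx.
Qed.

Let A q : 'M[R]_n := (\tr (W q))%:M + 2 *: skew_part q (W q).

Let A_frame q : U q -> B q *m A q = trace_plus_skew (h q) *m B q.
Proof.
move=> Uq; rewrite /A /trace_plus_skew /skew_part scalerA divff ?pnatr_eq0 //.
rewrite scale1r mulmxDr mulmxBr W_frame // adjoint_W // tr_W //.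
by rewrite mulmxDl mulmxBl scalar_mxC.
Qed.

Section AtPoint.
Variables (p : M) (Up : U p).

(** Components of the connection form in the direction [E i]. *)
Let G i : 'M[R]_n := \matrix_(j, k) dot (mdiff (F j) p (E i p)) (F k p).

Let G_skew i j k : G i j k = - G i k j.
Proof.
rewrite !mxE; have h1 := is_mdiff_dot (F_diff j Up) (F_diff k Up).
have h2 : is_mdiff p (fun q => dot (F j q) (F k q) : R^o) (cst 0).
  have h0 : is_mdiff p (fun=> (j == k)%:R : R^o) (cst 0).
    exact: (is_diff_cst ((j == k)%:R : R^o)).
  apply: is_mdiff_near h0; apply: filterS (near_open oU Up) => q Uq.
  by rewrite F_orth.
have h3 := etrans (esym (mdiffE h1 (E i p))) (mdiffE h2 (E i p)).
apply/esym/(etrans (congr1 -%R (dotC _ _))).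
by apply/eqP; rewrite eqr_oppLR -addr_eq0; apply/eqP.
Qed.

Let phi_inj : injective (fun u : 'rV[R]_n => u *m phi_mx p).
Proof. exact: row_free_inj (phi_mx_free p). Qed.

Let hnabla_frame i j : hnabla N (E j) p (E i p) = \sum_k G i j k *: E k p.
Proof.
apply: phi_inj; rewrite /= (hnabla_coef hN) mulmx_suml.
rewrite [LHS](F_expand Up); last exact: orthproj_orth (gauss_unit hN p).
apply: eq_bigr => k _; rewrite -scalemxAl; congr (_ *: _).
rewrite mxE /orthproj dotBl dotZl [dot (gauss N p) _]dotC F_normal mulr0 subr0.
by [].
Qed.

(** Leibniz rule in components; by orthonormality, taking the component along
[F l] picks out one of the derivatives [dc]. *)
Let deriv_frame (c dc : 'I_n -> _ -> R^o) V i l :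
  (forall j, is_mdiff p (c j) (dc j)) ->
  (forall q, U q -> V q = \sum_j c j q *: F j q) ->
  dot (mdiff V p (E i p)) (F l p) = dc l (E i p) + \sum_k c k p * G i k l.
Proof.
move=> cd VE.
have h1 := is_mdiff_sum (index_enum 'I_n)
  (fun j => is_mdiff_scale (cd j) (F_diff j Up)).
have h2 : is_mdiff p V (fun v =>
  \sum_j (c j p *: mdiff (F j) p v + dc j v *: F j p)).
  apply: is_mdiff_near h1; apply: filterS (near_open oU Up) => q Uq.
  exact: esym (VE q Uq).
apply: etrans (congr1 (fun w => dot w _) (mdiffE h2 (E i p))) _.
rewrite big_split dotDl !dot_suml addrC; congr (_ + _).
  rewrite (bigD1 l) //= dotZl F_orth // eqxx mulr1 big1 ?addr0 // => k kl.
  by rewrite dotZl F_orth // (negbTE kl) mulr0.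
by apply: eq_bigr => k _; rewrite dotZl mxE.
Qed.

Let dh v : 'M[R]_n := \matrix_(j, k) mdiff (fun q => h q j k : R^o) p v.

Let h_diff j k : is_mdiff p (fun q => h q j k : R^o) (fun v => dh v j k).
Proof.
have h1 := is_diffN (is_mdiff_dot (msmooth_is_mdiff (dgE_smooth j) Up)
  (F_diff k Up)).
have h2 : is_mdiff p (fun q => h q j k : R^o)
  (mdiff (fun q => h q j k : R^o) p).
  apply: differentiableP; have := is_diff_differentiable h1.
  by congr (differentiable _ _); apply/funext => x; rewrite /= mxE.
by apply: is_diff_eq h2 _; apply/funext => v; rewrite mxE.
Qed.

Let dgE_expand q i : U q -> dgE i q = \sum_j (- h q i j) *: F j q.
Proof.
move=> Uq; rewrite [LHS](F_expand Uq) ?mdiff_g_normal //.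
by apply: eq_bigr => j _; rewrite mxE opprK.
Qed.

Let deriv_dgE i j l :
  dot (mdiff (dgE j) p (E i p)) (F l p) =
  - (dh (E i p) j l + \sum_k h p j k * G i k l).
Proof.
rewrite (deriv_frame (c := fun k q => - h q j k) (dc := fun k v => - dh v j k)).
- rewrite opprD; congr (_ + _); rewrite -sumrN; apply: eq_bigr => k _.
  by rewrite mulNr.
- by move=> k; exact: is_diffN (h_diff j k).
- by move=> q; exact: dgE_expand.
Qed.

Let mdiff_g_frame (y : 'I_n -> R) l :
  dot (mdiff g p (\sum_k y k *: E k p)) (F l p) = - \sum_k y k * h p k l.
Proof.
have -> : mdiff g p (\sum_k y k *: E k p) = \sum_k y k *: dgE k p.
  rewrite /mdiff linear_sum; apply: eq_bigr => k _; exact: linearZZ.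
rewrite dot_suml -sumrN; apply: eq_bigr => k _.
by rewrite dotZl mxE mulrN opprK.
Qed.

(** The Codazzi equation: second derivatives of the Gauss map commute, and the
bracket of fields of the frame is read off from the vanishing of the torsion. *)
Let codazzi i j m :
  dh (E i p) j m + \sum_k h p j k * G i k m
  - (dh (E j p) i m + \sum_k h p i k * G j k m) =
  \sum_k (G i j k - G j i k) * h p k m.
Proof.
have L : lie (E i) (E j) p = \sum_k (G i j k - G j i k) *: E k p.
  have /eqP := hT oU (Es i) (Es j) Up.
  rewrite subr_eq0 => /eqP <-; rewrite !hnabla_frame -sumrB.
  by apply: eq_bigr => k _; rewrite scalerBl.
have := congr1 (fun w => dot w (F m p))
  (mdiff_lie oU g_smooth (Es i) (Es j) Up).
rewrite L mdiff_g_frame dotBl.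
rewrite -[X in dot (mdiff X _ _) _ - _]/(dgE j)
  -[X in _ - dot (mdiff X _ _) _]/(dgE i).
by rewrite !deriv_dgE -opprD => /oppr_inj.
Qed.

Let a q := trace_plus_skew (h q).

Let a_diff j k : is_mdiff p (fun q => a q j k : R^o)
  (fun v => trace_plus_skew (dh v) j k).
Proof.
have h1 := is_mdiff_sum (index_enum 'I_n) (fun m => h_diff m m).
have h2 := is_diffD (is_diffZ (j == k)%:R h1)
  (is_diffB (h_diff j k) (h_diff k j)).
have aE (b : 'M[R]_n) : trace_plus_skew b j k =
    (j == k)%:R *: (\sum_m b m m : R^o) + ((b j k : R^o) - b k j).
  by rewrite /trace_plus_skew !mxE -[in LHS]mulr_natl.
have e1 : (fun q => a q j k : R^o) \o bwd (chart_at p) = _ :=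
  funext (fun x => aE _).
have e2 : (fun v => trace_plus_skew (dh v) j k : R^o) = _ :=
  funext (fun x => aE _).
by rewrite /is_mdiff e1 e2; exact: h2.
Qed.

Let EA_expand q k : U q ->
  E k q *m A q *m phi_mx q = \sum_j a q k j *: F j q.
Proof.
move=> Uq; have := congr1 (fun X => row k (X *m phi_mx q)) (A_frame Uq).
rewrite !row_mul rowK => ->; rewrite -mulmxA mulmx_sum_row.
by apply: eq_bigr => j _; rewrite row_Phi mxE.
Qed.

Let dot_orthproj_F x l : dot (orthproj (g p) x) (F l p) = dot x (F l p).
Proof.
by rewrite /orthproj dotBl dotZl [dot (g p) _]dotC F_normal mulr0 subr0.
Qed.

Let divergence_frame l :
  dot (divergence N E A p *m phi_mx p) (F l p) =
  frame_div G (fun i => trace_plus_skew (dh (E i p))) (a p) l.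
Proof.
rewrite /divergence mulmx_suml dot_suml; apply: eq_bigr => i _.
rewrite mulmxBl dotBl (hnabla_coef hN) dot_orthproj_F addrA; congr (_ - _).
  apply: (deriv_frame (c := fun j q => a q i j)
    (dc := fun j v => trace_plus_skew (dh v) i j)) => [j|q Uq].
    exact: a_diff.
  exact: EA_expand.
rewrite hnabla_frame !mulmx_suml dot_suml; apply: eq_bigr => k _.
rewrite -!scalemxAl dotZl EA_expand // dot_suml (bigD1 l) //= big1 => [|j jl].
  by rewrite addr0 dotZl F_orth // eqxx mulr1.
by rewrite dotZl F_orth // (negbTE jl) mulr0.
Qed.

Variable D : ('rV[R]_n.+1 -> 'rV[R]_n.+1) -> 'rV[R]_n.+1 -> 'rV[R]_n.+1 ->
  'rV[R]_n.+1.
Variable gD : (M -> 'rV[R]_n.+1) -> M -> 'rV[R]_n -> 'rV[R]_n.+1.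
Hypotheses (hD : sphere_levi_civita D)
  (hgD : pullback_connection (gauss N) D gD).

Let gD_dgE i v : gD (dgE i) p v = orthproj (g p) (mdiff (dgE i) p v).
Proof.
apply: (pullback_connectionE oU g_smooth (gauss_unit hN) hD hgD) => //.
  by split=> // q Uq; exact: mdiff_g_normal.
exact: mdiff_g_normal.
Qed.

Let tension_frame l :
  dot (tension N gD g E p) (F l p) =
    - frame_div G (fun i => dh (E i p)) (h p) l.
Proof.
rewrite /tension dot_suml /frame_div -sumrN; apply: eq_bigr => i _.
rewrite -[gD _ _ _]/(gD (dgE i) p (E i p)) dotBl gD_dgE dot_orthproj_F.
by rewrite deriv_dgE hnabla_frame mdiff_g_frame opprK [in RHS]addrA [RHS]opprD opprK.
Qed.

(** Both sides are orthogonal to [g p] and have the same components in the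
frame. *)
Lemma tension_divergence :
  tension N gD g E p = - (divergence N E A p *m phi_mx p).
Proof.
rewrite [LHS](F_expand Up); last first.
  rewrite /tension dot_suml big1 // => i _.
  rewrite -[gD _ _ _]/(gD (dgE i) p (E i p)) gD_dgE dotBl.
  rewrite mdiff_g_normal // subr0.
  exact: orthproj_orth (gauss_unit hN p).
rewrite [RHS](F_expand Up); last by rewrite dotNl (gauss_orth hN) oppr0.
apply: eq_bigr => l _; rewrite dotNl tension_frame divergence_frame.
by rewrite (frame_div_trace_plus_skew l G_skew codazzi).
Qed.

End AtPoint.
End Frame.

Theorem theorem1 (R : realType) (n : nat) (Mt : weitzenbock R n.+1)
    (M : hypersurface Mt)
    (N : M -> 'rV[R]_n.+1) (hN : unit_normal N)
    (hT : torsion_free N)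
    (W : M -> 'M[R]_n) (hW : weingarten N W)
    (D : ('rV[R]_n.+1 -> 'rV[R]_n.+1) -> 'rV[R]_n.+1 -> 'rV[R]_n.+1 ->
         'rV[R]_n.+1) (hD : sphere_levi_civita D)
    (gD : (M -> 'rV[R]_n.+1) -> M -> 'rV[R]_n -> 'rV[R]_n.+1)
    (hgD : pullback_connection (gauss N) D gD) :
  let g := gauss N in
  let H := fun p : M => \tr (W p) in
  let A := fun p : M => (H p)%:M + 2 *: skew_part p (W p) in
  (forall (U : set M) (E : 'I_n -> M -> 'rV[R]_n), on_frame U E ->
     forall p : M, U p ->
       - phi_inv p (tension N gD g E p) = divergence N E A p) /\
  (harmonic_map N gD g <-> divergence_free N A).
Proof.
move=> g H A.
have key U E (hE : on_frame U E) p (Up : U p) :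
    tension N gD g E p = - (divergence N E A p *m phi_mx p).
  exact: (tension_divergence hN hT hW hE Up hD hgD).
split.
  move=> U E hE p Up; rewrite /phi_inv (key U E hE p Up) mulNmx opprK.
  exact: mulmxKp (phi_mx_free p) _.
split=> h U E hE p Up.
  have := h U E hE p Up; rewrite (key U E hE p Up) => /eqP.
  rewrite oppr_eq0 mulmx_free_eq0; last exact: phi_mx_free.
  by move/eqP.
by rewrite (key U E hE p Up) (h U E hE p Up) mul0mx oppr0.
Qed.
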